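(* Let $\mathcal P$ be a non-empty set. There is a bijective correspondence between (a) non-degenerate braided quivers $(\mathcal A,\sigma)$ over $\mathcal P$, and (b) structural pairs $(\mathcal G,\mathcal A)$ over $\mathcal P$.
   Context: Quivers. A quiver over $\mathcal P$ is a set $\mathcal A$ with maps $\mathfrak s,\mathfrak e:\mathcal A\to\mathcal P$ (source, end); morphisms of quivers over $\mathcal P$ preserve $\mathfrak s,\mathfrak e$. $\mathcal A\,{}_{\mathfrak e}\times_{\mathfrak s}\mathcal B=\{(a,b):\mathfrak e(a)=\mathfrak s(b)\}$ is a quiver with source $\mathfrak s(a)$ and end $\mathfrak e(b)$. The opposite quiver is $\mathcal A^{op}=\{a^{-1}:a\in\mathcal A\}$ (formal symbols) with $\mathfrak s(a^{-1})=\mathfrak e(a)$, $\mathfrak e(a^{-1})=\mathfrak s(a)$; the double is $\mathcal D\mathcal A=\mathcal A\sqcup\mathcal A^{op}$. A braided quiver is a pair $(\mathcal A,\sigma)$ with $\sigma$ an automorphism of the quiver $\mathcal A\,{}_{\mathfrak e}\times_{\mathfrak s}\mathcal A$ satisfying $(\sigma\times\mathrm{id})(\mathrm{id}\times\sigma)(\sigma\times\mathrm{id})=(\mathrm{id}\times\sigma)(\sigma\times\mathrm{id})(\mathrm{id}\times\sigma)$ on $\mathcal A\,{}_{\mathfrak e}\times_{\mathfrak s}\mathcal A\,{}_{\mathfrak e}\times_{\mathfrak s}\mathcal A$. Writing $\sigma(x,y)=(x\rightharpoonup y,x\leftharpoonup y)$, it is non-degenerate if for every $x\in\mathcal A$ the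 maps $x\rightharpoonup\_:\mathfrak s^{-1}(\mathfrak e(x))\to\mathfrak s^{-1}(\mathfrak s(x))$ and $\_\leftharpoonup x:\mathfrak e^{-1}(\mathfrak s(x))\to\mathfrak e^{-1}(\mathfrak e(x))$ are bijections. Groupoids. Groupoids have base $\mathcal P$ and morphisms are the identity on $\mathcal P$; the product $fg$ is defined when $\mathfrak e(f)=\mathfrak s(g)$. A left action of a groupoid $\mathcal G$ on a map $p:\mathcal E\to\mathcal P$ assigns $g\rightharpoonup e\in\mathcal E$ to each $(g,e)$ with $\mathfrak e(g)=p(e)$, with $p(g\rightharpoonup e)=\mathfrak s(g)$, $g\rightharpoonup(h\rightharpoonup e)=gh\rightharpoonup e$, $\mathrm{id}\rightharpoonup e=e$. A right action assigns $e\leftharpoonup g$ to each $(e,g)$ with $p(e)=\mathfrak s(g)$, with $p(e\leftharpoonup g)=\mathfrak e(g)$, $(e\leftharpoonup g)\leftharpoonup h=e\leftharpoonup gh$, $e\leftharpoonup\mathrm{id}=e$. The groupoid $\mathfrak{aut}\,p$ (also written $\mathfrak{aut}\,\mathcal E$) has as arrows the triples $(P,x,Q)$ with $x:p^{-1}(Q)\to p^{-1}(P)$ a bijection (source $P$, end $Q$, product = composition of maps); a left action of $\mathcal G$ on $p$ is the same as a groupoid morphism $\mathcal G\to\mathfrak{aut}\,p$ over $\mathcal P$, $g\mapsto(\mathfrak s(g),g\rightharpoonup\_,\mathfrak e(g))$. A matched pair of groupoids $(\mathcal V,\mathcal H)$ consists of groupoids over $\mathcal P$ with a left action $\rightharpoonup$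 of $\mathcal H$ on $\mathfrak s:\mathcal V\to\mathcal P$ and a right action $\leftharpoonup$ of $\mathcal V$ on $\mathfrak e:\mathcal H\to\mathcal P$ such that $\mathfrak e(x\rightharpoonup g)=\mathfrak s(x\leftharpoonup g)$, $x\rightharpoonup fg=(x\rightharpoonup f)((x\leftharpoonup f)\rightharpoonup g)$, $xy\leftharpoonup g=(x\leftharpoonup(y\rightharpoonup g))(y\leftharpoonup g)$. Its diagonal groupoid $\mathcal V\bowtie\mathcal H$ is $\mathcal V\,{}_{\mathfrak e}\times_{\mathfrak s}\mathcal H$ with product $(f,y)(h,z)=(f(y\rightharpoonup h),(y\leftharpoonup h)z)$. A braided groupoid is a groupoid $\mathcal G$ with actions $\rightharpoonup,\leftharpoonup$ making $(\mathcal G,\mathcal G)$ a matched pair and such that $fg=(f\rightharpoonup g)(f\leftharpoonup g)$. The map $(f,g)\mapsto(f\rightharpoonup g,f\leftharpoonup g)$ is then bijective, and its inverse is written $(f,g)\mapsto(f\rightharpoondown g,f\leftharpoondown g)$. For a braided groupoid $\mathcal G$, $(\mathcal G,\mathcal G\bowtie\mathcal G)$ is a matched pair (with $\mathcal V=\mathcal G$, $\mathcal H=\mathcal G\bowtie\mathcal G$) via $(g,h)\hookrightarrow f=g\rightharpoondown(h\rightharpoonup f)$ and $(g,h)\hookleftarrow f=(g\leftharpoondown(h\rightharpoonup f),\,h\leftharpoonup f)$. Representations. A representation of a matched pair $(\mathcal V,\mathcal H)$ is a quiver $\mathcal A$ over $\mathcal P$ with a left action $\rightharpoonup$ of $\mathcal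 H$ on $\mathfrak s:\mathcal A\to\mathcal P$ and a morphism of quivers $|\ |:\mathcal A\to\mathcal V$ with $|x\rightharpoonup a|=x\rightharpoonup|a|$. Then $\mathcal D\mathcal A$ is also a representation, with $|a^{-1}|=|a|^{-1}$ and $x\rightharpoonup a^{-1}=\bigl((x\leftharpoonup|a|^{-1})\rightharpoonup a\bigr)^{-1}$. If $\mathcal B$ is a representation of $(\mathcal G,\mathcal G\bowtie\mathcal G)$, with action written $\hookrightarrow$, put $g\rightharpoonup b=(\mathrm{id}_{\mathfrak s(g)},g)\hookrightarrow b$ and $g\rightharpoondown b=(g,\mathrm{id}_{\mathfrak e(g)})\hookrightarrow b$ for $g\in\mathcal G$; these are left actions of $\mathcal G$, and $\mathcal G$ acts on the left on $\mathfrak s:\mathcal B\,{}_{\mathfrak e}\times_{\mathfrak s}\mathcal B\to\mathcal P$ by $g\hookrightarrow(x,y)=(g\rightharpoonup x,(g\leftharpoonup|x|)\rightharpoondown y)$. Let $\nabla:\mathcal G\to\mathfrak{aut}(\mathcal B\,{}_{\mathfrak e}\times_{\mathfrak s}\mathcal B)$ denote the corresponding groupoid morphism. A structural pair is a pair $(\mathcal G,\mathcal A)$ with $\mathcal G$ a braided groupoid over $\mathcal P$ and $\mathcal A$ a representation of $(\mathcal G,\mathcal G\bowtie\mathcal G)$ such that (1) the image $|\mathcal A|$ generates the groupoid $\mathcal G$; (2) the map $\nabla:\mathcal G\to\mathfrak{aut}(\mathcal D\mathcal A\,{}_{\mathfrak e}\times_{\mathfrak s}\mathcal D\mathcal A)$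 (i.e. for $\mathcal B=\mathcal D\mathcal A$) is injective. *)

(* Defs.v *)
From mathcomp Require Import all_boot.
From mathcomp Require Import boolp.

Set Implicit Arguments.
Unset Strict Implicit.
Unset Printing Implicit Defensive.

(* Partial operations take a proof of their domain condition as last argument;
   laws between them are stated for all such proofs (which are irrelevant). *)

Record quiver (P : Type) := Quiver {
  arrow :> Type;
  src : arrow -> P;
  tgt : arrow -> P }.

Record qmor (P : Type) (A B : quiver P) := QMor {
  qfun :> A -> B;
  qfun_src : forall a, src (qfun a) = src a;
  qfun_tgt : forall a, tgt (qfun a) = tgt a }.

Definition qprod (P : Type) (A B : quiver P) : quiver P :=
  @Quiver P {p : A * B | tgt p.1 = src p.2}
    (fun p => src (sval p).1) (fun p => tgt (sval p).2).

Definition qpair (P : Type) (A B : quiver P) (a : A) (b : B)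
    (h : tgt a = src b) : qprod A B :=
  exist (fun p : A * B => tgt p.1 = src p.2) (a, b) h.

Lemma qpair_cong (P : Type) (A B : quiver P) (a a' : A) (b b' : B) h h' :
  a = a' -> b = b' -> qpair (a := a) (b := b) h = qpair (a := a') (b := b') h'.
Proof.
by move=> ea eb; subst a' b'; congr qpair; apply: Prop_irrelevance.
Qed.

Lemma qprodP (P : Type) (A B : quiver P) (p : qprod A B) :
  tgt (sval p).1 = src (sval p).2.
Proof. exact: (svalP p). Qed.

Lemma qpairE (P : Type) (A B : quiver P) (p : qprod A B) :
  p = qpair (qprodP p).
Proof.
by case: p => -[a b] h; rewrite /qpair; congr exist; apply: Prop_irrelevance.
Qed.

Section QProdMap.
Variables (P : Type) (A A' B B' : quiver P) (f : qmor A A') (g : qmor B B').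

Lemma qprod_map_subproof (p : qprod A B) :
  tgt (f (sval p).1) = src (g (sval p).2).
Proof. by rewrite qfun_tgt qfun_src qprodP. Qed.

Definition qprod_map : qmor (qprod A B) (qprod A' B') :=
  @QMor P (qprod A B) (qprod A' B') (fun p => qpair (qprod_map_subproof p))
    (fun p => qfun_src f (sval p).1) (fun p => qfun_tgt g (sval p).2).
End QProdMap.

Definition qid (P : Type) (A : quiver P) : qmor A A :=
  @QMor P A A (fun a => a) (fun=> erefl) (fun=> erefl).

Definition qassoc (P : Type) (A B C : quiver P)
    (t : qprod (qprod A B) C) : qprod A (qprod B C) :=
  @qpair P A (qprod B C) (sval (sval t).1).1
    (@qpair P B C (sval (sval t).1).2 (sval t).2 (qprodP t)) (qprodP (sval t).1).

Definition qassocV (P : Type) (A B C : quiver P)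
    (t : qprod A (qprod B C)) : qprod (qprod A B) C :=
  @qpair P (qprod A B) C
    (@qpair P A B (sval t).1 (sval (sval t).2).1 (qprodP t)) (sval (sval t).2).2
    (qprodP (sval t).2).

Definition qop (P : Type) (A : quiver P) : quiver P :=
  @Quiver P A (@tgt P A) (@src P A).

Definition qdouble (P : Type) (A : quiver P) : quiver P :=
  @Quiver P (A + qop A)%type
    (fun x => match x with inl a => src a | inr a => src a end)
    (fun x => match x with inl a => tgt a | inr a => tgt a end).

Definition fiber (E P : Type) (p : E -> P) (q : P) : Type := {e : E | p e = q}.

Definition mkfiber (E P : Type) (p : E -> P) (q : P) (e : E) (h : p e = q) :
    fiber p q :=
  exist (fun e => p e = q) e h.

Definition braid_equation (P : Type) (A : quiver P)
    (sigma : qmor (qprod A A) (qprod A A)) : Prop :=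
  let s12 := qprod_map sigma (qid A) : qprod (qprod A A) A -> _ in
  let s23 t := qassocV (qprod_map (qid A) sigma (qassoc t)) in
  forall t : qprod (qprod A A) A, s12 (s23 (s12 t)) = s23 (s12 (s23 t)).

Section NonDegenerate.
Variables (P : Type) (A : quiver P) (sigma : qmor (qprod A A) (qprod A A)).

Definition qleft (x y : A) (h : tgt x = src y) : A := (sval (sigma (qpair h))).1.
Definition qright (x y : A) (h : tgt x = src y) : A := (sval (sigma (qpair h))).2.

Definition qleft_fiber (x : A) (y : fiber (@src P A) (tgt x)) :
    fiber (@src P A) (src x) :=
  mkfiber (qfun_src sigma (qpair (esym (svalP y))) :
    src (qleft (esym (svalP y))) = src x).

Definition qright_fiber (x : A) (y : fiber (@tgt P A) (src x)) :
    fiber (@tgt P A) (tgt x) :=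
  mkfiber (qfun_tgt sigma (qpair (svalP y)) : tgt (qright (svalP y)) = tgt x).

Definition nondegenerate : Prop :=
  forall x : A, bijective (@qleft_fiber x) /\ bijective (@qright_fiber x).
End NonDegenerate.

(* The structures of non-degenerate braided quiver on a given quiver. *)
Record nd_braiding (P : Type) (A : quiver P) := NDBraiding {
  braiding :> qmor (qprod A A) (qprod A A);
  braiding_bij : bijective braiding;
  braiding_braid : braid_equation braiding;
  braiding_nd : nondegenerate braiding }.

Record groupoid (P : Type) := Groupoid {
  gquiver :> quiver P;
  gcomp : forall f g : gquiver, tgt f = src g -> gquiver;
  gid : P -> gquiver;
  ginv : gquiver -> gquiver;
  gcomp_src : forall f g h, src (@gcomp f g h) = src f;
  gcomp_tgt : forall f g h, tgt (@gcomp f g h) = tgt g;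
  gid_src : forall p, src (gid p) = p;
  gid_tgt : forall p, tgt (gid p) = p;
  ginv_src : forall f, src (ginv f) = tgt f;
  ginv_tgt : forall f, tgt (ginv f) = src f;
  gcompA : forall f g k h1 h2 h3 h4,
    @gcomp (@gcomp f g h1) k h2 = @gcomp f (@gcomp g k h3) h4;
  gcomp1l : forall p f h, @gcomp (gid p) f h = f;
  gcomp1r : forall p f h, @gcomp f (gid p) h = f;
  gcompV : forall f h, @gcomp f (ginv f) h = gid (src f);
  gcompVl : forall f h, @gcomp (ginv f) f h = gid (tgt f) }.

Arguments gcomp {P G} f g h : rename.
Arguments gid {P} G p : rename.
Arguments ginv {P G} f : rename.
Arguments gcompA {P G} {f g k} h1 h2 h3 h4 : rename.

Section GroupoidTheory.
Variables (P : Type) (G : groupoid P).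
Implicit Types f g k : G.

Lemma gcomp_cong f f' g g' h h' :
  f = f' -> g = g' -> gcomp f g h = gcomp f' g' h'.
Proof. by move=> ef eg; subst f' g'; congr gcomp; apply: Prop_irrelevance. Qed.

Lemma gcompKl f g h h' : gcomp (ginv f) (gcomp f g h) h' = g.
Proof.
have h1 : tgt (ginv f) = src f by rewrite ginv_tgt.
have h2 : tgt (gid G (tgt f)) = src g by rewrite gid_tgt.
have h3 : tgt (gcomp (ginv f) f h1) = src g by rewrite gcomp_tgt.
rewrite -(gcompA h1 h3 h h') -[RHS](gcomp1l (p := tgt f) h2).
by apply: gcomp_cong; rewrite ?gcompVl.
Qed.

Lemma gcomp_injl f g g' h h' : gcomp f g h = gcomp f g' h' -> g = g'.
Proof.
have h1 : tgt (ginv f) = src (gcomp f g h) by rewrite ginv_tgt gcomp_src.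
have h2 : tgt (ginv f) = src (gcomp f g' h') by rewrite ginv_tgt gcomp_src.
by move=> e; rewrite -(gcompKl h1) -[RHS](gcompKl h2); apply: gcomp_cong.
Qed.

Lemma ginv_uniq f g h p : gcomp f g h = gid G p -> g = ginv f.
Proof.
move=> e; have ep : p = src f by rewrite -(gcomp_src h) e gid_src.
have h' : tgt f = src (ginv f) by rewrite ginv_src.
by apply: (@gcomp_injl f _ _ h h'); rewrite e gcompV ep.
Qed.

Lemma ginvK f : ginv (ginv f) = f.
Proof.
have h : tgt (ginv f) = src f by rewrite ginv_tgt.
by apply/esym/(@ginv_uniq _ _ h (tgt f)); rewrite gcompVl.
Qed.

Lemma ginv1 p : ginv (gid G p) = gid G p.
Proof.
have h : tgt (gid G p) = src (gid G p) by rewrite gid_tgt gid_src.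
by apply/esym/(@ginv_uniq _ _ h p); rewrite gcomp1l.
Qed.

Lemma ginvM f g h h' : ginv (gcomp f g h) = gcomp (ginv g) (ginv f) h'.
Proof.
have h1 : tgt (gcomp f g h) = src (gcomp (ginv g) (ginv f) h').
  by rewrite gcomp_tgt gcomp_src ginv_src.
have h2 : tgt g = src (gcomp (ginv g) (ginv f) h').
  by rewrite gcomp_src ginv_src.
have h3 : tgt f = src (gcomp g (gcomp (ginv g) (ginv f) h') h2).
  by rewrite gcomp_src.
apply/esym/(@ginv_uniq _ _ h1 (src f)); rewrite (gcompA h h1 h2 h3).
have h4 : tgt f = src (ginv f) by rewrite ginv_src.
rewrite -(gcompV h4); apply: gcomp_cong => //.
have h5 : tgt (ginv (ginv g)) = src (gcomp (ginv g) (ginv f) h').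
  by rewrite ginvK.
by rewrite -[RHS](gcompKl h5); apply: gcomp_cong; rewrite ?ginvK.
Qed.

Lemma idem_id f h : gcomp f f h = f -> f = gid G (tgt f).
Proof.
have h1 : tgt f = src (gid G (tgt f)) by rewrite gid_src.
by move=> e; apply: (@gcomp_injl f _ _ h h1); rewrite e gcomp1r.
Qed.
End GroupoidTheory.

(* The wide subgroupoid generated by S. *)
Inductive generated (P : Type) (G : groupoid P) (S : G -> Prop) : G -> Prop :=
| generated_mem f : S f -> generated S f
| generated_id p : generated S (gid G p)
| generated_inv f : generated S f -> generated S (ginv f)
| generated_comp f g h :
    generated S f -> generated S g -> generated S (gcomp f g h).

Record left_action (P : Type) (G : groupoid P) (E : Type) (p : E -> P) :=
  LeftAction {
    lact :> forall (g : G) (e : E), tgt g = p e -> E;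
    lact_src : forall g e h, p (@lact g e h) = src g;
    lactM : forall g k e h1 h2 h3 h4,
      @lact g (@lact k e h1) h2 = @lact (gcomp g k h3) e h4;
    lact1 : forall q e h, @lact (gid G q) e h = e }.

Record right_action (P : Type) (G : groupoid P) (E : Type) (p : E -> P) :=
  RightAction {
    ract :> forall (e : E) (g : G), p e = src g -> E;
    ract_tgt : forall e g h, p (@ract e g h) = tgt g;
    ractM : forall e g k h1 h2 h3 h4,
      @ract (@ract e g h1) k h2 = @ract e (gcomp g k h3) h4;
    ract1 : forall q e h, @ract e (gid G q) h = e }.

Arguments lactM {P G E p} L {g k e} h1 h2 h3 h4 : rename.
Arguments ractM {P G E p} R {e g k} h1 h2 h3 h4 : rename.

Lemma lact_cong P (G : groupoid P) E (p : E -> P) (L : left_action G p)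
  g g' e e' h h' : g = g' -> e = e' -> L g e h = L g' e' h'.
Proof. by move=> ef eg; subst g' e'; congr (lact L); apply: Prop_irrelevance. Qed.

Lemma ract_cong P (G : groupoid P) E (p : E -> P) (R : right_action G p)
  e e' g g' h h' : e = e' -> g = g' -> R e g h = R e' g' h'.
Proof. by move=> ef eg; subst g' e'; congr (ract R); apply: Prop_irrelevance. Qed.

(* Closes equations up to the proofs of domain conditions. *)
Ltac pcongr :=
  repeat first [ reflexivity | done | apply: gcomp_cong | apply: lact_cong
               | apply: ract_cong | apply: qpair_cong | congr ginv ].

(* The arrows (P, x, Q) of the groupoid aut p; its composition plays no role in
   the injectivity of a morphism into it. *)
Record aut_arrow (E P : Type) (p : E -> P) := AutArrow {
  aut_src : P;
  aut_tgt : P;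
  aut_map : fiber p aut_tgt -> fiber p aut_src;
  aut_bij : bijective aut_map }.

Section ActionAut.
Variables (P : Type) (G : groupoid P) (E : Type) (p : E -> P).
Variable L : left_action G p.

Definition action_map (g : G) (e : fiber p (tgt g)) : fiber p (src g) :=
  mkfiber (lact_src L (esym (svalP e))).

Lemma action_map_bij (g : G) : bijective (@action_map g).
Proof.
have hs (e : fiber p (src g)) : tgt (ginv g) = p (sval e).
  by rewrite ginv_tgt (svalP e).
have ht e : p (L (ginv g) (sval e) (hs e)) = tgt g by rewrite lact_src ginv_src.
exists (fun e => mkfiber (ht e)) => -[e he]; apply: eq_exist => /=.
  have h3 : tgt (ginv g) = src g by rewrite ginv_tgt.
  have h4 : tgt (gcomp (ginv g) g h3) = p e by rewrite gcomp_tgt he.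
  have h5 : tgt (gid G (tgt g)) = p e by rewrite gid_tgt he.
  by rewrite (lactM L _ _ h3 h4) -[RHS](lact1 L h5); apply: lact_cong; rewrite ?gcompVl.
have h3 : tgt g = src (ginv g) by rewrite ginv_src.
have h4 : tgt (gcomp g (ginv g) h3) = p e by rewrite gcomp_tgt ginv_tgt he.
have h5 : tgt (gid G (src g)) = p e by rewrite gid_tgt he.
by rewrite (lactM L _ _ h3 h4) -[RHS](lact1 L h5); apply: lact_cong; rewrite ?gcompV.
Qed.

Definition action_aut (g : G) : aut_arrow p := AutArrow (action_map_bij g).
End ActionAut.

Record matched_pair (P : Type) (V H : groupoid P) := MatchedPair {
  mpl : left_action H (@src P V);
  mpr : right_action V (@tgt P H);
  mp_mid : forall x g h, tgt (mpl x g h) = src (mpr x g h);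
  mplM : forall x f g h1 h2 h3 h4 h5,
    mpl x (gcomp f g h1) h2 =
    gcomp (mpl x f h3) (mpl (mpr x f h3) g h4) h5;
  mprM : forall x y g h1 h2 h3 h4 h5,
    mpr (gcomp x y h1) g h2 =
    gcomp (mpr x (mpl y g h3) h4) (mpr y g h3) h5 }.

Arguments mplM {P V H} M {x f g} h1 h2 h3 h4 h5 : rename.
Arguments mprM {P V H} M {x y g} h1 h2 h3 h4 h5 : rename.

Section MatchedPairTheory.
Variables (P : Type) (V H : groupoid P) (M : matched_pair V H).
Notation L := (mpl M).
Notation R := (mpr M).

Lemma mpl1 (x : H) p h : L x (gid V p) h = gid V (src x).
Proof.
have h1 : tgt (gid V p) = src (gid V p) by rewrite gid_src gid_tgt.
have h2 : tgt x = src (gcomp (gid V p) (gid V p) h1) by rewrite gcomp1l.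
have h4 : tgt (R x (gid V p) h) = src (gid V p) by rewrite ract_tgt gid_src gid_tgt.
have h5 : tgt (L x (gid V p) h) = src (L (R x (gid V p) h) (gid V p) h4).
  by rewrite lact_src mp_mid.
have e := mplM M h1 h2 h h4 h5.
have h6 : tgt (L x (gid V p) h) = src (L x (gid V p) h).
  by rewrite mp_mid lact_src ract1.
have e1 : gcomp (L x (gid V p) h) (L x (gid V p) h) h6 = L x (gid V p) h.
  transitivity (L x (gcomp (gid V p) (gid V p) h1) h2).
    by rewrite e; apply: gcomp_cong => //; apply: lact_cong; rewrite ?ract1.
  by apply: lact_cong; rewrite ?gcomp1l.
by rewrite (idem_id e1) mp_mid ract1.
Qed.

Lemma mpr1 p (g : V) h : R (gid H p) g h = gid H (tgt g).
Proof.
have h1 : tgt (gid H p) = src (gid H p) by rewrite gid_src gid_tgt.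
have h2 : tgt (gcomp (gid H p) (gid H p) h1) = src g by rewrite gcomp1l.
have h4 : tgt (gid H p) = src (L (gid H p) g h) by rewrite lact_src gid_src gid_tgt.
have h5 : tgt (R (gid H p) (L (gid H p) g h) h4) = src (R (gid H p) g h).
  by rewrite ract_tgt mp_mid.
have e := mprM M h1 h2 h h4 h5.
have h6 : tgt (R (gid H p) g h) = src (R (gid H p) g h).
  by rewrite ract_tgt -mp_mid lact1.
have e1 : gcomp (R (gid H p) g h) (R (gid H p) g h) h6 = R (gid H p) g h.
  transitivity (R (gcomp (gid H p) (gid H p) h1) g h2).
    by rewrite e; apply: gcomp_cong => //; apply: ract_cong; rewrite ?lact1.
  by apply: ract_cong; rewrite ?gcomp1l.
by rewrite (idem_id e1) ract_tgt.
Qed.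

Lemma mplV (x : H) (g : V) h h1 h2 :
  L (R x g h) (ginv g) h1 = ginv (L x g h) /\ R (R x g h) (ginv g) h2 = x.
Proof.
have h3 : tgt g = src (ginv g) by rewrite ginv_src.
have h4 : tgt x = src (gcomp g (ginv g) h3) by rewrite gcomp_src.
have h5 : tgt x = src (gid V (src g)) by rewrite gid_src.
split.
  have h6 : tgt (L x g h) = src (L (R x g h) (ginv g) h1).
    by rewrite lact_src mp_mid.
  apply: (@ginv_uniq _ _ _ _ h6 (src x)).
  rewrite -(mplM M h3 h4 h h1 h6) -(mpl1 h5).
  by apply: lact_cong; rewrite ?gcompV.
rewrite (ractM R h h2 h3 h4) -[RHS](ract1 R h5).
by apply: ract_cong; rewrite ?gcompV.
Qed.

Lemma mprV (x : H) (g : V) h h1 h2 :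
  R (ginv x) (L x g h) h1 = ginv (R x g h) /\ L (ginv x) (L x g h) h2 = g.
Proof.
have h3 : tgt (ginv x) = src x by rewrite ginv_tgt.
have h4 : tgt (gcomp (ginv x) x h3) = src g by rewrite gcomp_tgt.
have h5 : tgt (gid H (tgt x)) = src g by rewrite gid_tgt.
split.
  have h6 : tgt (R (ginv x) (L x g h) h1) = src (R x g h).
    by rewrite ract_tgt mp_mid.
  have e : gcomp (R (ginv x) (L x g h) h1) (R x g h) h6 = gid H (tgt g).
    rewrite -(mprM M h3 h4 h h1 h6) -(mpr1 h5).
    by apply: ract_cong; rewrite ?gcompVl.
  by have := ginv_uniq e => ->; rewrite ginvK.
rewrite (lactM L h h2 h3 h4) -[RHS](lact1 L h5).
by apply: lact_cong; rewrite ?gcompVl.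
Qed.
End MatchedPairTheory.

Section Diagonal.
Variables (P : Type) (V H : groupoid P) (M : matched_pair V H).
Notation L := (mpl M).
Notation R := (mpr M).
Notation D := (qprod V H).

Section Comp.
Variables (X Y : D) (h : tgt X = src Y).
Let f := (sval X).1.
Let y := (sval X).2.
Let k := (sval Y).1.
Let z := (sval Y).2.

Lemma diag_comp_h1 : tgt f = src (L y k h).
Proof. by rewrite lact_src; apply: qprodP. Qed.
Lemma diag_comp_h2 : tgt (R y k h) = src z.
Proof. by rewrite ract_tgt; apply: qprodP. Qed.
Lemma diag_comp_h3 :
  tgt (gcomp f (L y k h) diag_comp_h1) = src (gcomp (R y k h) z diag_comp_h2).
Proof. by rewrite gcomp_tgt gcomp_src mp_mid. Qed.
Definition diag_comp : D := qpair diag_comp_h3.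
End Comp.

Lemma diag_id_h p : tgt (gid V p) = src (gid H p).
Proof. by rewrite gid_tgt gid_src. Qed.
Definition diag_id (p : P) : D := qpair (diag_id_h p).

Lemma diag_inv_h (X : D) : tgt (ginv (sval X).2) = src (ginv (sval X).1).
Proof. by rewrite ginv_tgt ginv_src qprodP. Qed.
Definition diag_inv (X : D) : D := qpair (mp_mid M (diag_inv_h X)).

Lemma diag_src (X Y : D) h : src (@diag_comp X Y h) = src X.
Proof. exact: gcomp_src. Qed.
Lemma diag_tgt (X Y : D) h : tgt (@diag_comp X Y h) = tgt Y.
Proof. exact: gcomp_tgt. Qed.
Lemma diag_id_src p : src (diag_id p) = p. Proof. exact: gid_src. Qed.
Lemma diag_id_tgt p : tgt (diag_id p) = p. Proof. exact: gid_tgt. Qed.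
Lemma diag_inv_src X : src (diag_inv X) = tgt X.
Proof. by rewrite /= lact_src ginv_src. Qed.
Lemma diag_inv_tgt X : tgt (diag_inv X) = src X.
Proof. by rewrite /= ract_tgt ginv_tgt. Qed.

Lemma diagA (X Y Z : D) h1 h2 h3 h4 :
  @diag_comp (@diag_comp X Y h1) Z h2 = @diag_comp X (@diag_comp Y Z h3) h4.
Proof.
case: X Y Z h1 h2 h3 h4 => -[f y] hX [[k z] hY] [[l w] hZ] /= h1 h2 h3 h4.
have hX' : tgt f = src y := hX.
have hY' : tgt k = src z := hY.
have hZ' : tgt l = src w := hZ.
have hzl : tgt z = src l by [].
have hyzl : tgt y = src (gcomp k (L z l hzl) (diag_comp_h1 (X:=qpair hY) (Y:=qpair hZ) hzl)).
  by rewrite gcomp_src.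
have a1 : tgt (R y k h1) = src (L z l hzl) by rewrite ract_tgt lact_src.
have a2 : tgt (L y k h1) = src (L (R y k h1) (L z l hzl) a1).
  by rewrite mp_mid lact_src.
have a3 : tgt (R (R y k h1) (L z l hzl) a1) = src (R z l hzl).
  by rewrite ract_tgt mp_mid.
have a4 : tgt f = src (gcomp (L y k h1) (L (R y k h1) (L z l hzl) a1) a2).
  by rewrite gcomp_src lact_src.
have a5 : tgt (gcomp f (L y k h1) (diag_comp_h1 (X:=qpair hX) (Y:=qpair hY) h1)) = src (L (R y k h1) (L z l hzl) a1).
  by rewrite gcomp_tgt.
have a6 : tgt (gcomp (R (R y k h1) (L z l hzl) a1) (R z l hzl) a3) = src w.
  by rewrite gcomp_tgt ract_tgt.
have a7 : tgt (R z l hzl) = src w by rewrite ract_tgt.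
have a8 : tgt (R (R y k h1) (L z l hzl) a1) = src (gcomp (R z l hzl) w a7).
  by rewrite gcomp_src.
have b1 : tgt (R y k h1) = src z by rewrite ract_tgt.
have b2 : tgt (gcomp (R y k h1) z b1) = src l by rewrite gcomp_tgt.
apply: qpair_cong.
  transitivity (gcomp f (gcomp (L y k h1) (L (R y k h1) (L z l hzl) a1) a2) a4).
    rewrite -(gcompA (diag_comp_h1 (X:=qpair hX) (Y:=qpair hY) h1) a5).
    apply: gcomp_cong => //=.
    rewrite (lactM L _ _ b1 b2).
    by pcongr.
  apply: gcomp_cong => //=.
  by rewrite -(mplM M _ hyzl); pcongr.
transitivity (gcomp (gcomp (R (R y k h1) (L z l hzl) a1) (R z l hzl) a3) w a6).
  apply: gcomp_cong => //=.
  rewrite -(mprM M b1 b2).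
  by pcongr.
rewrite (gcompA _ _ a7 a8); apply: gcomp_cong; last by pcongr.
rewrite (ractM R _ _ _ hyzl).
by pcongr.
Qed.

Lemma diag1l p X h : @diag_comp (diag_id p) X h = X.
Proof.
case: X h => -[f y] hX h; apply: eq_exist; congr pair => /=.
  by rewrite gcomp1l lact1.
have h1 : tgt (gid H (tgt f)) = src y by rewrite gid_tgt.
by rewrite -[RHS](gcomp1l h1); apply: gcomp_cong; rewrite ?mpr1.
Qed.

Lemma diag1r p X h : @diag_comp X (diag_id p) h = X.
Proof.
case: X h => -[f y] hX h; apply: eq_exist; congr pair => /=.
  have h1 : tgt f = src (gid V (src y)) by rewrite gid_src.
  by rewrite -[RHS](gcomp1r h1); apply: gcomp_cong; rewrite ?mpl1.
by rewrite gcomp1r ract1.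
Qed.

Lemma diagV X h : @diag_comp X (diag_inv X) h = diag_id (src X).
Proof.
case: X h => -[f y] hX h; have hX' : tgt f = src y := hX.
have h1 : tgt y = src (ginv y) by rewrite ginv_src.
have h2 : tgt (gcomp y (ginv y) h1) = src (ginv f).
  by rewrite gcomp_tgt ginv_tgt ginv_src.
have h3 : tgt f = src (ginv f) by rewrite ginv_src.
have h4 : tgt (gid H (src y)) = src (ginv f) by rewrite gid_tgt ginv_src.
apply: qpair_cong => /=.
  rewrite -(gcompV h3); apply: gcomp_cong => //.
  rewrite (lactM L _ _ h1 h2) -[RHS](lact1 L h4).
  by apply: lact_cong; rewrite ?gcompV.
rewrite -(mprM M h1 h2) -[RHS](_ : R (gid H (src y)) (ginv f) h4 = _).
  by apply: ract_cong; rewrite ?gcompV.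
by rewrite mpr1 ginv_tgt.
Qed.

Lemma diagVl X h : @diag_comp (diag_inv X) X h = diag_id (tgt X).
Proof.
case: X h => -[f y] hX h; have hX' : tgt f = src y := hX.
have h1 : tgt (ginv f) = src f by rewrite ginv_tgt.
have h2 : tgt (ginv y) = src (gcomp (ginv f) f h1).
  by rewrite ginv_tgt gcomp_src ginv_src.
have h3 : tgt (ginv y) = src y by rewrite ginv_tgt.
have h4 : tgt (ginv y) = src (gid V (tgt f)) by rewrite ginv_tgt gid_src.
apply: qpair_cong => /=.
  rewrite -(mplM M h1 h2) -[RHS](_ : L (ginv y) (gid V (tgt f)) h4 = _).
    by apply: lact_cong; rewrite ?gcompVl.
  by rewrite mpl1 ginv_src.
rewrite -(gcompVl h3); apply: gcomp_cong => //.
rewrite (ractM R _ _ h1 h2) -[RHS](ract1 R h4).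
by apply: ract_cong; rewrite ?gcompVl.
Qed.

Definition diagonal : groupoid P :=
  Groupoid diag_src diag_tgt diag_id_src diag_id_tgt diag_inv_src diag_inv_tgt
    diagA diag1l diag1r diagV diagVl.
End Diagonal.

(* The map (f, g) |-> (f |> g, f <| g) of a matched pair (G, G) is inverted by
   (f, g) |-> ((g^-1 <| f^-1)^-1, (g^-1 |> f^-1)^-1): see mp_inverseK and
   mp_inverseVK below. This inverse is again a matched pair. *)
Section InverseMatchedPair.
Variables (P : Type) (G : groupoid P) (M : matched_pair G G).
Notation L := (mpl M).
Notation R := (mpr M).

Lemma mpi_h (f g : G) : tgt f = src g -> tgt (ginv g) = src (ginv f).
Proof. by rewrite ginv_tgt ginv_src. Qed.

Definition mpi_lfun (f g : G) (h : tgt f = src g) : G :=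
  ginv (R (ginv g) (ginv f) (mpi_h h)).
Definition mpi_rfun (f g : G) (h : tgt f = src g) : G :=
  ginv (L (ginv g) (ginv f) (mpi_h h)).

Lemma mpi_lsrc f g h : src (@mpi_lfun f g h) = src f.
Proof. by rewrite ginv_src ract_tgt ginv_tgt. Qed.

Lemma mpi_lM f k g h1 h2 h3 h4 :
  @mpi_lfun f (@mpi_lfun k g h1) h2 = @mpi_lfun (gcomp f k h3) g h4.
Proof.
rewrite /mpi_lfun; congr ginv.
have a1 := mpi_h h3.
have a2 : tgt (ginv g) = src (gcomp (ginv k) (ginv f) a1).
  by rewrite ginv_tgt gcomp_src ginv_src.
have a3 : tgt (R (ginv g) (ginv k) (mpi_h h1)) = src (ginv f).
  by rewrite ract_tgt.
transitivity (R (R (ginv g) (ginv k) (mpi_h h1)) (ginv f) a3).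
  by apply: ract_cong; rewrite ?ginvK.
rewrite (ractM R _ _ a1 a2); apply: ract_cong => //.
by rewrite (ginvM _ a1).
Qed.

Lemma mpi_l1 q g h : @mpi_lfun (gid G q) g h = g.
Proof.
have h1 : tgt (ginv g) = src (gid G q) by rewrite ginv_tgt -h gid_src gid_tgt.
rewrite /mpi_lfun -[RHS]ginvK -[ginv g in RHS](ract1 R h1); congr ginv.
by apply: ract_cong; rewrite ?ginv1.
Qed.

Definition mpi_l : left_action G (@src P G) := LeftAction mpi_lsrc mpi_lM mpi_l1.

Lemma mpi_rtgt f g h : tgt (@mpi_rfun f g h) = tgt g.
Proof. by rewrite ginv_tgt lact_src ginv_src. Qed.

Lemma mpi_rM f g k h1 h2 h3 h4 :
  @mpi_rfun (@mpi_rfun f g h1) k h2 = @mpi_rfun f (gcomp g k h3) h4.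
Proof.
rewrite /mpi_rfun; congr ginv.
have a1 := mpi_h h3.
have a2 : tgt (gcomp (ginv k) (ginv g) a1) = src (ginv f).
  by rewrite gcomp_tgt; apply: mpi_h.
have a3 : tgt (ginv k) = src (L (ginv g) (ginv f) (mpi_h h1)).
  by rewrite lact_src.
transitivity (L (ginv k) (L (ginv g) (ginv f) (mpi_h h1)) a3).
  by apply: lact_cong; rewrite ?ginvK.
rewrite (lactM L _ _ a1 a2); apply: lact_cong => //.
by rewrite (ginvM _ a1).
Qed.

Lemma mpi_r1 q f h : @mpi_rfun f (gid G q) h = f.
Proof.
have h1 : tgt (gid G q) = src (ginv f) by rewrite ginv_src h gid_src gid_tgt.
rewrite /mpi_rfun -[RHS]ginvK -[ginv f in RHS](lact1 L h1); congr ginv.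
by apply: lact_cong; rewrite ?ginv1.
Qed.

Definition mpi_r : right_action G (@tgt P G) :=
  RightAction mpi_rtgt mpi_rM mpi_r1.

Lemma mpi_mid x g h : tgt (mpi_l x g h) = src (mpi_r x g h).
Proof. by rewrite ginv_tgt ginv_src mp_mid. Qed.

Lemma mpi_lgM x f g h1 h2 h3 h4 h5 :
  mpi_l x (gcomp f g h1) h2 =
  gcomp (mpi_l x f h3) (mpi_l (mpi_r x f h3) g h4) h5.
Proof.
have a1 := mpi_h h1.
have a2 : tgt (gcomp (ginv g) (ginv f) a1) = src (ginv x).
  by rewrite gcomp_tgt; apply: mpi_h.
have a3 : tgt (ginv g) = src (L (ginv f) (ginv x) (mpi_h h3)).
  by rewrite lact_src.
have a5 : tgt (R (ginv g) (L (ginv f) (ginv x) (mpi_h h3)) a3) =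
          src (R (ginv f) (ginv x) (mpi_h h3)).
  by rewrite ract_tgt mp_mid.
have a6 : tgt (ginv (R (ginv f) (ginv x) (mpi_h h3))) =
  src (ginv (R (ginv g) (L (ginv f) (ginv x) (mpi_h h3)) a3)).
  exact: mpi_h.
transitivity (ginv (R (gcomp (ginv g) (ginv f) a1) (ginv x) a2)).
  by congr ginv; apply: ract_cong; rewrite ?(ginvM _ a1).
rewrite (mprM M a1 a2 (mpi_h h3) a3 a5) (ginvM _ a6).
apply: gcomp_cong => //; congr ginv.
by apply: ract_cong; rewrite ?ginvK.
Qed.

Lemma mpi_rgM x y g h1 h2 h3 h4 h5 :
  mpi_r (gcomp x y h1) g h2 =
  gcomp (mpi_r x (mpi_l y g h3) h4) (mpi_r y g h3) h5.
Proof.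
have a1 := mpi_h h1.
have a2 : tgt (ginv g) = src (gcomp (ginv y) (ginv x) a1).
  by rewrite gcomp_src; apply: mpi_h.
have a4 : tgt (R (ginv g) (ginv y) (mpi_h h3)) = src (ginv x).
  by rewrite ract_tgt.
have a5 : tgt (L (ginv g) (ginv y) (mpi_h h3)) =
          src (L (R (ginv g) (ginv y) (mpi_h h3)) (ginv x) a4).
  by rewrite lact_src mp_mid.
have a6 : tgt (ginv (L (R (ginv g) (ginv y) (mpi_h h3)) (ginv x) a4)) =
  src (ginv (L (ginv g) (ginv y) (mpi_h h3))).
  exact: mpi_h.
transitivity (ginv (L (ginv g) (gcomp (ginv y) (ginv x) a1) a2)).
  by congr ginv; apply: lact_cong; rewrite ?(ginvM _ a1).
rewrite (mplM M a1 a2 (mpi_h h3) a4 a5) (ginvM _ a6).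
apply: gcomp_cong => //; congr ginv.
by apply: lact_cong; rewrite ?ginvK.
Qed.

Definition mp_inverse : matched_pair G G :=
  MatchedPair mpi_mid mpi_lgM mpi_rgM.

Definition mp_braid (N : matched_pair G G) (p : qprod G G) : qprod G G :=
  qpair (mp_mid N (qprodP p)).

Lemma mp_inverseK : cancel (mp_braid M) (mp_braid mp_inverse).
Proof.
case=> -[f g] h; have h' : tgt f = src g := h.
have a1 : tgt (ginv f) = src (L f g h') by rewrite ginv_tgt lact_src.
have [r1 l1] := mprV (h := h') a1 a1.
have a2 : tgt (R (ginv f) (L f g h') a1) = src (ginv (L f g h')).
  by rewrite ract_tgt ginv_src.
have [l2 r2] := mplV (h := a1) a2 a2.
apply: qpair_cong => /=.
  rewrite /mpi_lfun -[RHS]ginvK; congr ginv; rewrite -[RHS]r2.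
  by apply: ract_cong; rewrite ?r1; pcongr.
rewrite /mpi_rfun -[RHS]ginvK; congr ginv; rewrite -[g in RHS]l1 -[RHS]l2.
by apply: lact_cong; rewrite ?r1; pcongr.
Qed.
End InverseMatchedPair.

Lemma mp_inverseVK (P : Type) (G : groupoid P) (M : matched_pair G G) :
  cancel (mp_braid (mp_inverse M)) (mp_braid M).
Proof.
have E (p : qprod G G) :
    mp_braid (mp_inverse (mp_inverse M)) p = mp_braid M p.
  case: p => -[f g] h; apply: qpair_cong => /=.
    rewrite /mpi_lfun /= /mpi_rfun ginvK.
    by apply: lact_cong; rewrite ?ginvK.
  rewrite /mpi_rfun /= /mpi_lfun ginvK.
  by apply: ract_cong; rewrite ?ginvK.
by move=> p; rewrite -[RHS](mp_inverseK (mp_inverse M)) E.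
Qed.

Record braided_groupoid (P : Type) := BraidedGroupoid {
  bgroupoid :> groupoid P;
  bg_mp : matched_pair bgroupoid bgroupoid;
  bg_comm : forall f g h h',
    gcomp f g h = gcomp (mpl bg_mp f g h) (mpr bg_mp f g h) h' }.

Arguments bg_comm {P} G {f g} h h' : rename.

Section DoubleMatchedPair.
Variables (P : Type) (G : braided_groupoid P).

(* up_l, up_r are the two actions of G, dn_l, dn_r the components of the inverse
   of (f, g) |-> (up_l f g, up_r f g). *)
Definition up_l : left_action G (@src P G) := mpl (bg_mp G).
Definition up_r : right_action G (@tgt P G) := mpr (bg_mp G).
Definition dn_l : left_action G (@src P G) := mpl (mp_inverse (bg_mp G)).
Definition dn_r : right_action G (@tgt P G) := mpr (mp_inverse (bg_mp G)).

Lemma up_mid f g h : tgt (up_l f g h) = src (up_r f g h).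
Proof. exact: mp_mid. Qed.
Lemma dn_mid f g h : tgt (dn_l f g h) = src (dn_r f g h).
Proof. exact: mp_mid. Qed.

Lemma up_dn f g h h' : dn_l (up_l f g h) (up_r f g h) h' = f /\
  dn_r (up_l f g h) (up_r f g h) h' = g.
Proof.
have := congr1 sval (mp_inverseK (bg_mp G) (qpair h)).
rewrite (_ : mp_braid (bg_mp G) (qpair h) = qpair h'); last by apply: qpair_cong; rewrite /up_l /up_r; pcongr.
by move=> /= [e1 e2]; split; [rewrite -[RHS]e1|rewrite -[RHS]e2];
   rewrite /dn_l /dn_r; pcongr.
Qed.

Lemma dn_up f g h h' : up_l (dn_l f g h) (dn_r f g h) h' = f /\
  up_r (dn_l f g h) (dn_r f g h) h' = g.
Proof.
have := congr1 sval (mp_inverseVK (bg_mp G) (qpair h)).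
rewrite (_ : mp_braid (mp_inverse _) (qpair h) = qpair h');
  last by apply: qpair_cong; rewrite /dn_l /dn_r; pcongr.
by move=> /= [e1 e2]; split; [rewrite -[RHS]e1|rewrite -[RHS]e2];
   rewrite /up_l /up_r; pcongr.
Qed.

Lemma up_dn_mixed h g k a1 a2 a3 a4 b1 b2 b3 b4 :
  dn_l (up_l h g a1) (up_l (up_r h g a2) k a3) a4 =
    up_l h (dn_l g k b1) b2 /\
  dn_r (up_l h g a1) (up_l (up_r h g a2) k a3) a4 =
    up_l (up_r h (dn_l g k b1) b2) (dn_r g k b3) b4.
Proof.
pose m := dn_l g k b1; pose n := dn_r g k b1.
have mn : tgt m = src n by exact: dn_mid.
have [e1 e2] := dn_up mn; rewrite -/m -/n in e1 e2.
have b4' : tgt (up_r h m b2) = src n by rewrite ract_tgt.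
pose a := up_l h m b2; pose b := up_l (up_r h m b2) n b4'.
have ab : tgt a = src b by rewrite /a /b lact_src up_mid.
have ha : tgt h = src (up_l m n mn) by rewrite lact_src.
have hmn : tgt (gcomp h m b2) = src n by rewrite gcomp_tgt.
have E1 : up_l a b ab = up_l h g a1.
  transitivity (up_l (gcomp h m b2) n hmn).
    have c1 : tgt a = src (up_r h m b2) by exact: up_mid.
    have c2 : tgt (gcomp a (up_r h m b2) c1) = src n by rewrite gcomp_tgt.
    rewrite (lactM up_l b4' ab c1 c2); apply: lact_cong => //.
    by rewrite (bg_comm G b2 c1).
  by rewrite -(lactM up_l mn ha b2 hmn); apply: lact_cong.
have E2 : up_r a b ab = up_l (up_r h g a2) k a3.
  have c0 : tgt h = src (gcomp m n mn) by rewrite gcomp_src.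
  have c1 : tgt (up_l a b ab) = src (up_r a b ab) by exact: up_mid.
  have c2 : tgt (up_l a b ab) = src (up_l (up_r h g a2) k a3) by rewrite E1.
  have c3 : tgt g = src k by [].
  have c4 : tgt h = src (gcomp g k c3) by rewrite gcomp_src.
  have a3' : tgt (up_r h g a1) = src k by rewrite ract_tgt.
  have c5 : tgt (up_l h g a1) = src (up_l (up_r h g a1) k a3').
    by rewrite lact_src up_mid.
  apply: (@gcomp_injl _ _ (up_l a b ab) _ _ c1 c2).
  rewrite -(bg_comm G ab c1) /a /b /m /n.
  rewrite -(mplM (bg_mp G) mn c0 b2 b4' ab).
  transitivity (up_l h (gcomp g k c3) c4).
    apply: lact_cong => //; rewrite (bg_comm G mn (up_mid mn)).
    by apply: gcomp_cong.
  rewrite (mplM (bg_mp G) c3 c4 a1 a3' c5).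
  by apply: gcomp_cong; [rewrite E1|pcongr].
have [f1 f2] := up_dn (up_mid ab).
split; first by rewrite -[RHS]f1; apply: lact_cong.
rewrite -[RHS](_ : b = _); last by rewrite /b /n; pcongr.
by rewrite -f2; apply: ract_cong.
Qed.

Arguments up_dn_mixed {h g k} a1 a2 a3 a4 b1 b2 b3 b4.

(* The diagonal groupoid of (G, G); dbl_mp below is the matched pair it forms
   with G. *)
Definition dgroupoid : groupoid P := diagonal (bg_mp G).

Section Ops.
Variables (X : dgroupoid) (f : G) (h : tgt X = src f).

Lemma dbl_h1 : tgt (sval X).1 = src (up_l (sval X).2 f h).
Proof. by rewrite lact_src; apply: qprodP. Qed.

Definition dbl_lfun : G := dn_l (sval X).1 (up_l (sval X).2 f h) dbl_h1.

Lemma dbl_h2 :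
  tgt (dn_r (sval X).1 (up_l (sval X).2 f h) dbl_h1) = src (up_r (sval X).2 f h).
Proof. by rewrite ract_tgt up_mid. Qed.

Definition dbl_rfun : dgroupoid := qpair dbl_h2.
End Ops.

Lemma dbl_lsrc X f h : src (@dbl_lfun X f h) = src X.
Proof. exact: lact_src. Qed.

Lemma dbl_lM X Y f h1 h2 h3 h4 :
  @dbl_lfun X (@dbl_lfun Y f h1) h2 = @dbl_lfun (gcomp X Y h3) f h4.
Proof.
case: X Y h1 h2 h3 h4 => -[g h] hX [[g' h'] hY] h1 h2 h3 h4.
have hY' : tgt g' = src h' := hY.
have e1 : tgt h' = src f := h1.
have e3 : tgt h = src g' := h3.
rewrite /dbl_lfun.
pose k := up_l h' f e1.
have a3 : tgt (up_r h g' e3) = src k by rewrite ract_tgt lact_src.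
have a4 : tgt (up_l h g' e3) = src (up_l (up_r h g' e3) k a3).
  by rewrite lact_src up_mid.
have b1 : tgt g' = src k by rewrite lact_src.
have b2 : tgt h = src (dn_l g' k b1) by rewrite lact_src.
have b4 : tgt (up_r h (dn_l g' k b1) b2) = src (dn_r g' k b1).
  by rewrite ract_tgt dn_mid.
have [E _] := up_dn_mixed e3 e3 a3 a4 b1 b2 b1 b4.
have c1 : tgt g = src (up_l h (dn_l g' k b1) b2) by rewrite lact_src.
have c2 : tgt g = src (dn_l (up_l h g' e3) (up_l (up_r h g' e3) k a3) a4).
  by rewrite E.
have c3 : tgt g = src (up_l h g' e3) by rewrite lact_src.
have c4 : tgt (gcomp g (up_l h g' e3) c3) = src (up_l (up_r h g' e3) k a3).
  by rewrite gcomp_tgt.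
transitivity (dn_l g (dn_l (up_l h g' e3) (up_l (up_r h g' e3) k a3) a4) c2).
  apply: lact_cong => //; rewrite E; pcongr.
rewrite (lactM dn_l a4 c2 c3 c4); apply: lact_cong; first by pcongr.
have d1 : tgt (up_r h g' e3) = src h' by rewrite ract_tgt.
have d2 : tgt (gcomp (up_r h g' e3) h' d1) = src f by rewrite gcomp_tgt.
by rewrite (lactM up_l e1 a3 d1 d2); pcongr.
Qed.

Lemma dbl_l1 q f h : @dbl_lfun (gid dgroupoid q) f h = f.
Proof. by rewrite /dbl_lfun lact1 lact1. Qed.

Definition dbl_l : left_action dgroupoid (@src P G) :=
  LeftAction dbl_lsrc dbl_lM dbl_l1.

Lemma dbl_rtgt X f h : tgt (@dbl_rfun X f h) = tgt f.
Proof. exact: ract_tgt. Qed.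

Lemma dbl_rM X f k h1 h2 h3 h4 :
  @dbl_rfun (@dbl_rfun X f h1) k h2 = @dbl_rfun X (gcomp f k h3) h4.
Proof.
case: X h1 h2 h4 => -[g h] hX h1 h2 h4.
have hX' : tgt g = src h := hX.
have e1 : tgt h = src f := h1.
have e4 : tgt h = src (gcomp f k h3) := h4.
have a1 : tgt (up_r h f e1) = src k by rewrite ract_tgt.
have a2 : tgt (up_l h f e1) = src (up_l (up_r h f e1) k a1).
  by rewrite lact_src up_mid.
apply: qpair_cong; last first.
  transitivity (up_r (up_r h f e1) k a1); first by pcongr.
  by rewrite (ractM up_r e1 a1 h3 e4); pcongr.
have a3 : tgt g = src (up_l h f e1) by rewrite lact_src.
have a4 : tgt (dn_r g (up_l h f e1) a3) = src (up_l (up_r h f e1) k a1).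
  by rewrite ract_tgt.
have a5 : tgt g = src (gcomp (up_l h f e1) (up_l (up_r h f e1) k a1) a2).
  by rewrite gcomp_src.
transitivity (dn_r g (gcomp (up_l h f e1) (up_l (up_r h f e1) k a1) a2) a5).
  by rewrite -(ractM dn_r a3 a4 a2 a5); pcongr.
by apply: ract_cong => //; rewrite -(mplM (bg_mp G) h3 e4 e1 a1 a2); pcongr.
Qed.

Lemma dbl_r1 q X h : @dbl_rfun X (gid G q) h = X.
Proof.
case: X h => -[g h] hX e; have e' : tgt h = src (gid G q) := e.
have hX' : tgt g = src h := hX.
apply: eq_exist; congr pair; last exact: ract1.
have a : tgt g = src (gid G (src h)) by rewrite gid_src.
rewrite -[RHS](ract1 dn_r a); apply: ract_cong => //.
by rewrite /up_l mpl1.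
Qed.

Definition dbl_r : right_action G (@tgt P dgroupoid) :=
  RightAction dbl_rtgt dbl_rM dbl_r1.

Lemma dbl_mid X f h : tgt (dbl_l X f h) = src (dbl_r X f h).
Proof. exact: dn_mid. Qed.

Lemma dbl_lgM X f k h1 h2 h3 h4 h5 :
  dbl_l X (gcomp f k h1) h2 =
  gcomp (dbl_l X f h3) (dbl_l (dbl_r X f h3) k h4) h5.
Proof.
case: X h2 h3 h4 h5 => -[g h] hX h2 h3 h4 h5; rewrite /dbl_l.
have hX' : tgt g = src h := hX.
have e1 : tgt h = src f := h3.
have e4 : tgt h = src (gcomp f k h1) := h2.
have a1 : tgt (up_r h f e1) = src k by rewrite ract_tgt.
have a2 : tgt (up_l h f e1) = src (up_l (up_r h f e1) k a1).
  by rewrite lact_src up_mid.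
have a3 : tgt g = src (up_l h f e1) by rewrite lact_src.
have a4 : tgt (dn_r g (up_l h f e1) a3) = src (up_l (up_r h f e1) k a1).
  by rewrite ract_tgt.
have a5 : tgt g = src (gcomp (up_l h f e1) (up_l (up_r h f e1) k a1) a2).
  by rewrite gcomp_src.
have a6 : tgt (dn_l g (up_l h f e1) a3) =
    src (dn_l (dn_r g (up_l h f e1) a3) (up_l (up_r h f e1) k a1) a4).
  by rewrite lact_src dn_mid.
transitivity (dn_l g (gcomp (up_l h f e1) (up_l (up_r h f e1) k a1) a2) a5).
  apply: (@lact_cong _ _ _ _ dn_l) => //.
  by rewrite -(mplM (bg_mp G) h1 e4 e1 a1 a2); pcongr.
rewrite (mplM (mp_inverse (bg_mp G)) a2 a5 a3 a4 a6).
by apply: gcomp_cong; rewrite /dn_l; pcongr.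
Qed.

Lemma dbl_rgM X Y f h1 h2 h3 h4 h5 :
  dbl_r (gcomp X Y h1) f h2 =
  gcomp (dbl_r X (dbl_l Y f h3) h4) (dbl_r Y f h3) h5.
Proof.
case: X Y h1 h2 h3 h4 h5 => -[g h] hX [[g' h'] hY] h1 h2 h3 h4 h5.
have hX' : tgt g = src h := hX.
have hY' : tgt g' = src h' := hY.
have e3 : tgt h' = src f := h3.
have e1 : tgt h = src g' := h1.
pose k := up_l h' f e3.
have a3 : tgt (up_r h g' e1) = src k by rewrite ract_tgt lact_src.
have a4 : tgt (up_l h g' e1) = src (up_l (up_r h g' e1) k a3).
  by rewrite lact_src up_mid.
have b1 : tgt g' = src k by rewrite lact_src.
have b2 : tgt h = src (dn_l g' k b1) by rewrite lact_src.
have b4 : tgt (up_r h (dn_l g' k b1) b2) = src (dn_r g' k b1).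
  by rewrite ract_tgt dn_mid.
have [E1 E2] := up_dn_mixed e1 e1 a3 a4 b1 b2 b1 b4.
have d1 : tgt (up_r h g' e1) = src h' by rewrite ract_tgt.
have d2 : tgt (gcomp (up_r h g' e1) h' d1) = src f by rewrite gcomp_tgt.
have mn := dn_mid b1.
apply: qpair_cong.
  have c3 : tgt g = src (up_l h g' e1) by rewrite lact_src.
  have c4 : tgt (gcomp g (up_l h g' e1) c3) = src (up_l (up_r h g' e1) k a3).
    by rewrite gcomp_tgt.
  have c5 : tgt g = src (dn_l (up_l h g' e1) (up_l (up_r h g' e1) k a3) a4).
    by rewrite lact_src.
  have c6 : tgt (dn_r g (dn_l (up_l h g' e1) (up_l (up_r h g' e1) k a3) a4) c5)
     = src (dn_r (up_l h g' e1) (up_l (up_r h g' e1) k a3) a4).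
    by rewrite ract_tgt dn_mid.
  transitivity (dn_r (gcomp g (up_l h g' e1) c3) (up_l (up_r h g' e1) k a3) c4).
    apply: ract_cong; first by pcongr.
    by rewrite (lactM up_l e3 a3 d1 d2); pcongr.
  rewrite (mprM (mp_inverse (bg_mp G)) c3 c4 a4 c5 c6); apply: gcomp_cong.
    by apply: ract_cong => //; rewrite [LHS]E1; pcongr.
  by rewrite [LHS]E2; pcongr; rewrite /dn_r; pcongr.
have c1 : tgt (up_r (up_r h g' e1) k a3) = src (up_r h' f e3).
  by rewrite ract_tgt up_mid.
transitivity (gcomp (up_r (up_r h g' e1) k a3) (up_r h' f e3) c1).
  transitivity (up_r (gcomp (up_r h g' e1) h' d1) f d2); first by pcongr.
  by rewrite (mprM (bg_mp G) d1 d2 e3 a3 c1); pcongr.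
apply: gcomp_cong; last by pcongr.
have f1 : tgt g' = src k by [].
have f2 : tgt h = src (gcomp g' k f1) by rewrite gcomp_src.
rewrite (ractM up_r e1 a3 f1 f2).
have f3 : tgt h = src (gcomp (dn_l g' k b1) (dn_r g' k b1) mn).
  by rewrite gcomp_src.
transitivity (up_r h (gcomp (dn_l g' k b1) (dn_r g' k b1) mn) f3).
  apply: ract_cong => //; rewrite (bg_comm G mn (up_mid mn)).
  have [u v] := dn_up mn.
  exact: gcomp_cong (esym u) (esym v).
by rewrite -(ractM up_r b2 b4 mn f3); pcongr.
Qed.

Definition dbl_mp : matched_pair G dgroupoid :=
  MatchedPair dbl_mid dbl_lgM dbl_rgM.
End DoubleMatchedPair.

(* The structures of representation of M on a given quiver. *)
Record representation (P : Type) (V H : groupoid P) (M : matched_pair V H)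
    (A : quiver P) := Representation {
  rep_act :> left_action H (@src P A);
  rep_val : qmor A V;
  rep_val_act : forall x a h h',
    rep_val (rep_act x a h) = mpl M x (rep_val a) h' }.

Arguments rep_val_act {P V H M A} r {x a} h h' : rename.

Section DoubleRepresentation.
Variables (P : Type) (V H : groupoid P) (M : matched_pair V H) (A : quiver P).
Variable r : representation M A.
Notation L := (mpl M).
Notation R := (mpr M).
Notation DA := (qdouble A).

Definition double_valfun (b : DA) : V :=
  match b with inl a => rep_val r a | inr a => ginv (rep_val r a) end.

Lemma double_val_src b : src (double_valfun b) = src b.
Proof. by case: b => a /=; rewrite ?ginv_src ?qfun_src ?qfun_tgt. Qed.
Lemma double_val_tgt b : tgt (double_valfun b) = tgt b.
Proof. by case: b => a /=; rewrite ?ginv_tgt ?qfun_src ?qfun_tgt. Qed.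

Definition double_val : qmor DA V := QMor double_val_src double_val_tgt.

Section Opposite.
Variables (x : H) (a : A) (h : tgt x = tgt a).
Lemma double_act_h1 : tgt x = src (ginv (rep_val r a)).
Proof. by rewrite ginv_src qfun_tgt. Qed.
Lemma double_act_h2 : tgt (R x (ginv (rep_val r a)) double_act_h1) = src a.
Proof. by rewrite ract_tgt ginv_tgt qfun_src. Qed.
Definition double_act_op : A :=
  r (R x (ginv (rep_val r a)) double_act_h1) a double_act_h2.

Lemma double_val_op (h' : tgt x = src (ginv (rep_val r a))) :
  ginv (rep_val r double_act_op) = L x (ginv (rep_val r a)) h'.
Proof.
have b1 : tgt (R x (ginv (rep_val r a)) h') = src (rep_val r a).
  by rewrite ract_tgt ginv_tgt.
have b2 : tgt (R x (ginv (rep_val r a)) h') = src (ginv (ginv (rep_val r a))).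
  by rewrite ginvK.
have [E _] := mplV b2 b2.
rewrite (rep_val_act r _ (etrans double_act_h2 (esym (qfun_src _ a)))).
by rewrite -[RHS]ginvK -[X in _ = ginv X]E; congr ginv; apply: lact_cong;
   rewrite ?ginvK; pcongr.
Qed.
End Opposite.

Definition double_actfun (x : H) (b : DA) : tgt x = src b -> DA :=
  match b with
  | inl a => fun h => inl (r x a h)
  | inr a => fun h => inr (double_act_op h)
  end.

Lemma double_act_src x b h : src (@double_actfun x b h) = src x.
Proof.
case: b h => a h /=; first exact: lact_src.
rewrite -(qfun_tgt (rep_val r)) -ginv_src (double_val_op h (double_act_h1 h)).
exact: lact_src.
Qed.

Lemma double_actM x y b h1 h2 h3 h4 :
  @double_actfun x (@double_actfun y b h1) h2 =
  @double_actfun (gcomp x y h3) b h4.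
Proof.
case: b h1 h2 h4 => a h1 h2 h4 /=; first by congr inl; exact: lactM.
move: a h1 h2 h4 => /= a; change (arrow A) in a => h1 h2 h4.
congr inr; rewrite /double_act_op.
set g := ginv (rep_val r a).
have E := double_val_op h1 (double_act_h1 h1).
have e1 : tgt y = src g := double_act_h1 h1.
have e2 : tgt (R y g e1) = src a by rewrite ract_tgt ginv_tgt qfun_src.
have e3 : tgt x = src (L y g e1) by rewrite lact_src.
have e4 : tgt (R x (L y g e1) e3) = src (R y g e1) by rewrite ract_tgt mp_mid.
have e5 : tgt (R x (L y g e1) e3) = src (r (R y g e1) a e2) by rewrite lact_src.
have e6 : tgt (gcomp (R x (L y g e1) e3) (R y g e1) e4) = src a.
  by rewrite gcomp_tgt.
transitivity (r (R x (L y g e1) e3) (r (R y g e1) a e2) e5).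
  apply: lact_cong; last by rewrite /double_act_op; pcongr.
  by apply: ract_cong => //; rewrite [LHS]E; pcongr.
rewrite (lactM r e2 e5 e4 e6); apply: lact_cong => //.
have e7 : tgt (gcomp x y h3) = src g by rewrite gcomp_tgt.
by rewrite -(mprM M h3 e7); pcongr.
Qed.

Lemma double_act1 q b h : @double_actfun (gid H q) b h = b.
Proof.
case: b h => a h /=; first by congr inl; exact: lact1.
move: a h => /= a; change (arrow A) in a => h.
congr inr; rewrite /double_act_op.
have e : tgt (gid H (src a)) = src a by rewrite gid_tgt.
rewrite -[RHS](lact1 r e); apply: lact_cong => //.
by rewrite mpr1 ginv_tgt qfun_src.
Qed.

Definition double_act : left_action H (@src P DA) :=
  LeftAction double_act_src double_actM double_act1.

Lemma double_valE x b h h' :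
  double_val (double_act x b h) = L x (double_val b) h'.
Proof.
case: b h h' => a h h' /=; first exact: rep_val_act.
exact: double_val_op.
Qed.

Definition rep_double : representation M DA := Representation double_valE.
End DoubleRepresentation.

Section RepresentationTheory.
Variables (P : Type) (G : braided_groupoid P) (B : quiver P).
Variable r : representation (dbl_mp G) B.

Definition emb_up (g : G) : dgroupoid G := @qpair P G G (gid G (src g)) g (gid_tgt G _).
Definition emb_dn (g : G) : dgroupoid G :=
  @qpair P G G g (gid G (tgt g)) (esym (gid_src G _)).

Lemma emb_dn_tgt g : tgt (emb_dn g) = tgt g.
Proof. exact: gid_tgt. Qed.
Lemma emb_up_src g : src (emb_up g) = src g.
Proof. exact: gid_src. Qed.

Lemma emb_up_comp f g h h' : emb_up (gcomp f g h) = gcomp (emb_up f) (emb_up g) h'.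
Proof.
have a1 : tgt f = src (gid G (src g)) by rewrite gid_src.
have a2 : tgt (gid G (src f)) = src (gid G (src f)) by rewrite gid_src gid_tgt.
apply: qpair_cong.
  rewrite gcomp_src -[LHS](gcomp1l a2); apply: gcomp_cong => //.
  by rewrite mpl1.
by apply: gcomp_cong => //; rewrite ract1.
Qed.

Lemma emb_dn_comp f g h h' : emb_dn (gcomp f g h) = gcomp (emb_dn f) (emb_dn g) h'.
Proof.
have a2 : tgt (gid G (tgt g)) = src (gid G (tgt g)) by rewrite gid_src gid_tgt.
apply: qpair_cong.
  by apply: gcomp_cong => //; rewrite lact1.
rewrite gcomp_tgt -[LHS](gcomp1l a2); apply: gcomp_cong => //.
by rewrite mpr1.
Qed.

Lemma emb_up1 p : emb_up (gid G p) = gid (dgroupoid G) p.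
Proof. by apply: qpair_cong; rewrite ?gid_src. Qed.
Lemma emb_dn1 p : emb_dn (gid G p) = gid (dgroupoid G) p.
Proof. by apply: qpair_cong; rewrite ?gid_tgt. Qed.

Definition up_actfun (g : G) (b : B) (h : tgt g = src b) : B := r (emb_up g) b h.

Lemma up_act_src g b h : src (@up_actfun g b h) = src g.
Proof. by rewrite lact_src emb_up_src. Qed.

Lemma up_actM f g b h1 h2 h3 h4 :
  @up_actfun f (@up_actfun g b h1) h2 = @up_actfun (gcomp f g h3) b h4.
Proof.
have a1 : tgt (emb_up f) = src (emb_up g) by rewrite emb_up_src.
have a2 : tgt (gcomp (emb_up f) (emb_up g) a1) = src b by rewrite gcomp_tgt.
pose h1' : tgt (emb_up g) = src b := h1.
pose h2' : tgt (emb_up f) = src (r (emb_up g) b h1') := h2.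
apply: etrans (lactM r h1' h2' a1 a2) _.
by apply: lact_cong => //; rewrite -emb_up_comp.
Qed.

Lemma up_act1 q b h : @up_actfun (gid G q) b h = b.
Proof.
have a : tgt (gid (dgroupoid G) q) = src b by rewrite gid_tgt -h gid_tgt.
by rewrite -[RHS](lact1 r a); apply: lact_cong => //; rewrite emb_up1.
Qed.

Definition up_act : left_action G (@src P B) :=
  LeftAction up_act_src up_actM up_act1.

Definition dn_actfun (g : G) (b : B) (h : tgt g = src b) : B :=
  r (emb_dn g) b (etrans (emb_dn_tgt g) h).

Lemma dn_act_src g b h : src (@dn_actfun g b h) = src g.
Proof. by rewrite lact_src. Qed.

Lemma dn_actM f g b h1 h2 h3 h4 :
  @dn_actfun f (@dn_actfun g b h1) h2 = @dn_actfun (gcomp f g h3) b h4.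
Proof.
have a1 : tgt (emb_dn f) = src (emb_dn g) by rewrite emb_dn_tgt.
have a2 : tgt (gcomp (emb_dn f) (emb_dn g) a1) = src b.
  by rewrite gcomp_tgt emb_dn_tgt.
have a3 := etrans (emb_dn_tgt g) h1.
have a4 : tgt (emb_dn f) = src (r (emb_dn g) b a3).
  by rewrite lact_src emb_dn_tgt.
transitivity (r (emb_dn f) (r (emb_dn g) b a3) a4).
  by rewrite /dn_actfun; pcongr.
by rewrite (lactM r a3 a4 a1 a2); apply: lact_cong => //; rewrite -emb_dn_comp.
Qed.

Lemma dn_act1 q b h : @dn_actfun (gid G q) b h = b.
Proof.
have a : tgt (gid (dgroupoid G) q) = src b by rewrite gid_tgt -h gid_tgt.
by rewrite -[RHS](lact1 r a); apply: lact_cong => //; rewrite emb_dn1.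
Qed.

Definition dn_act : left_action G (@src P B) :=
  LeftAction dn_act_src dn_actM dn_act1.

Lemma rep_val_up g b h h' :
  rep_val r (up_act g b h) = up_l G g (rep_val r b) h'.
Proof.
have a : tgt (emb_up g) = src (rep_val r b) := h'.
have c : tgt (gid G (src g)) = src (up_l G g (rep_val r b) h').
  by rewrite gid_tgt lact_src.
pose h0 : tgt (emb_up g) = src b := h.
rewrite -[RHS](lact1 (dn_l G) c); apply: etrans (rep_val_act r h0 a) _.
by apply: (@lact_cong _ _ _ _ (dn_l G)) => //; exact: lact_cong.
Qed.

Lemma rep_val_dn g b h h' :
  rep_val r (dn_act g b h) = dn_l G g (rep_val r b) h'.
Proof.
have a : tgt (emb_dn g) = src (rep_val r b) by rewrite emb_dn_tgt.
rewrite [LHS](rep_val_act r _ a).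
by apply: (@lact_cong _ _ _ _ (dn_l G)) => //; exact: lact1.
Qed.

Section PairAction.
Variables (g : G) (p : qprod B B) (h : tgt g = src p).
Let x := (sval p).1.
Let y := (sval p).2.

Lemma pair_act_h1 : tgt g = src (rep_val r x).
Proof. by rewrite qfun_src. Qed.
Lemma pair_act_h2 : tgt (up_r G g (rep_val r x) pair_act_h1) = src y.
Proof. by rewrite ract_tgt qfun_tgt; apply: qprodP. Qed.
Lemma pair_act_h3 : tgt (up_act g x h) =
  src (dn_act (up_r G g (rep_val r x) pair_act_h1) y pair_act_h2).
Proof.
by rewrite -(qfun_tgt (rep_val r)) (rep_val_up h pair_act_h1) up_mid lact_src.
Qed.
Definition pair_actfun : qprod B B := qpair pair_act_h3.
End PairAction.

Lemma pair_act_src g p h : src (@pair_actfun g p h) = src g.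
Proof. exact: up_act_src. Qed.

Lemma pair_actM f g p h1 h2 h3 h4 :
  @pair_actfun f (@pair_actfun g p h1) h2 = @pair_actfun (gcomp f g h3) p h4.
Proof.
apply: qpair_cong; first exact: up_actM.
case: p h1 h2 h4 => -[x y] hp h1 h2 h4.
have hp' : tgt x = src y := hp.
set v := rep_val r x.
have e1 : tgt g = src v := pair_act_h1 h1.
have e2 : tgt (up_r G g v e1) = src y by rewrite ract_tgt qfun_tgt.
have e3 : tgt f = src (up_l G g v e1) by rewrite lact_src.
have e4 : tgt (up_r G f (up_l G g v e1) e3) = src (up_r G g v e1).
  by rewrite ract_tgt up_mid.
have e5 : tgt (up_r G f (up_l G g v e1) e3) = src (dn_act (up_r G g v e1) y e2).
  by rewrite lact_src.
have e6 : tgt (gcomp (up_r G f (up_l G g v e1) e3) (up_r G g v e1) e4) = src y.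
  by rewrite gcomp_tgt.
transitivity (dn_act (up_r G f (up_l G g v e1) e3) (dn_act (up_r G g v e1) y e2) e5).
  apply: (@lact_cong _ _ _ _ dn_act); last by apply: (@lact_cong _ _ _ _ dn_act) => //; pcongr.
  by apply: ract_cong => //; rewrite [LHS](rep_val_up h1 e1).
rewrite (lactM dn_act e2 e5 e4 e6); apply: (@lact_cong _ _ _ _ dn_act) => //.
have e7 : tgt (gcomp f g h3) = src v by rewrite gcomp_tgt.
by rewrite -(mprM (bg_mp G) h3 e7); pcongr.
Qed.

Lemma pair_act1 q p h : @pair_actfun (gid G q) p h = p.
Proof.
rewrite [RHS]qpairE; apply: qpair_cong; first exact: up_act1.
have e : tgt (gid G (tgt (sval p).1)) = src (sval p).2.
  by rewrite gid_tgt qprodP.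
rewrite -[RHS](lact1 dn_act e); apply: (@lact_cong _ _ _ _ dn_act) => //.
by rewrite /up_r mpr1 qfun_tgt.
Qed.

Definition pair_act : left_action G (@src P (qprod B B)) :=
  LeftAction pair_act_src pair_actM pair_act1.

Definition nabla : G -> aut_arrow (@src P (qprod B B)) := action_aut pair_act.
End RepresentationTheory.

(* The braiding of a representation r of (G, G |><| G): sigma(x, y) = (u, v) with
   u = up_act |x| y and v = dn_act |u|^-1 x. On G itself this is the pair
   (up_l x y, up_r x y), since dn_l u (up_r x y) = x for u = up_l x y. *)
Section RepresentationBraiding.
Variables (P : Type) (G : braided_groupoid P) (A : quiver P).
Variables (r : representation (dbl_mp G) A) (x y : A) (h : tgt x = src y).

Lemma rep_left_h : tgt (rep_val r x) = src y.
Proof. by rewrite qfun_tgt. Qed.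
Definition rep_left : A := up_act r (rep_val r x) y rep_left_h.

Lemma rep_right_h : tgt (ginv (rep_val r rep_left)) = src x.
Proof. by rewrite ginv_tgt qfun_src lact_src qfun_src. Qed.
Definition rep_right : A := dn_act r (ginv (rep_val r rep_left)) x rep_right_h.
End RepresentationBraiding.

(* The structural pairs whose quiver is A. *)
Record structural_pair (P : Type) (A : quiver P) := StructuralPair {
  sp_groupoid : braided_groupoid P;
  sp_rep :> representation (dbl_mp sp_groupoid) A;
  sp_gen : forall g : sp_groupoid,
    generated (fun v => exists a : A, v = rep_val sp_rep a) g;
  sp_inj : injective (nabla (rep_double sp_rep)) }.

(* Isomorphism of structural pairs inducing the identity on A: a structural pair
   determines G only up to such an isomorphism. *)
Definition sp_isomorphic (P : Type) (A : quiver P) (S S' : structural_pair A) :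
    Prop :=
  let G := sp_groupoid S in
  let G' := sp_groupoid S' in
  exists psi : qmor G G',
    [/\ bijective psi,
        forall f g h h', psi (gcomp f g h) = gcomp (psi f) (psi g) h',
        (forall f g h h', psi (up_l G f g h) = up_l G' (psi f) (psi g) h') /\
        (forall f g h h', psi (up_r G f g h) = up_r G' (psi f) (psi g) h'),
        forall a, psi (rep_val S a) = rep_val S' a
      & forall (X : dgroupoid G) a h h',
          (S' : representation (dbl_mp G') A) (qprod_map psi psi X) a h' =
          (S : representation (dbl_mp G) A) X a h].

(* Main.v *)
Require Import Defs.
From mathcomp Require Import all_boot.
From mathcomp Require Import boolp.

(* For a structural pair, sigma(x, y) = (u, v) says that |x| maps y to u and |v|
   maps y^-1 to u^-1, and, for the action of the inverse braiding, that |u| maps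
   v to x and |y| maps v^-1 to x^-1. So sigma determines the action of the
   generators |x|, hence of all of G, on the double of A by both actions. The
   injectivity of nabla amounts to the faithfulness of these two actions together,
   so G is recovered, up to isomorphism, as a groupoid of pairs of partial
   bijections of the double of A.

   Conversely, for a non-degenerate braiding, the four formulas above define such
   partial bijections for each x, and G is the groupoid they generate. Its braiding
   comes from the grids obtained by pasting boxes sigma(x, y) = (u, v): a grid with
   left side g and bottom side h has top g |> h and right side g <| h. The point is
   that the grid depends only on g and h. For g = |x| the right side is |x'| for an
   x' read off from the action of h, and the top is then |x| h |x'|^-1; since this
   is intrinsic in h, uniqueness follows by pasting. *)

Set Implicit Arguments.
Unset Strict Implicit.
Unset Printing Implicit Defensive.

(** * Total versions of the partial operations *)

Lemma inj_surj_bij (T U : Type) (f : T -> U) :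
  injective f -> (forall u, exists t, f t = u) -> bijective f.
Proof.
move=> fi fs; exists (fun u => projT1 (cid (fs u))) => [t|u].
  by apply: fi; case: cid.
by case: cid.
Qed.

Section TotalOperations.
Variables (P : Type) (G : groupoid P).
Implicit Types f g k : G.

(** Removing the domain proof from the term makes rewriting with equations possible. The junk value
    [f] off the domain lets [src_cmp] hold without a hypothesis. *)
Definition cmp f g : G :=
  if pselect (tgt f = src g) is left h then gcomp f g h else f.

Lemma cmpE f g h : gcomp f g h = cmp f g.
Proof.
by rewrite /cmp; case: pselect => // h'; apply: gcomp_cong.
Qed.

Lemma src_cmp f g : src (cmp f g) = src f.
Proof. by rewrite /cmp; case: pselect => // h; rewrite gcomp_src. Qed.

Lemma tgt_cmp f g : tgt f = src g -> tgt (cmp f g) = tgt g.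
Proof. by move=> h; rewrite -(cmpE h) gcomp_tgt. Qed.

Lemma cmpA f g k : tgt f = src g -> tgt g = src k ->
  cmp (cmp f g) k = cmp f (cmp g k).
Proof.
move=> h1 h3.
have h2 : tgt (gcomp f g h1) = src k by rewrite gcomp_tgt.
have h4 : tgt f = src (gcomp g k h3) by rewrite gcomp_src.
by have := gcompA h1 h2 h3 h4; rewrite !cmpE.
Qed.

Lemma cmp1l p f : src f = p -> cmp (gid G p) f = f.
Proof.
move=> h; have h' : tgt (gid G p) = src f by rewrite gid_tgt.
by rewrite -(cmpE h') gcomp1l.
Qed.

Lemma cmp1r p f : tgt f = p -> cmp f (gid G p) = f.
Proof.
move=> h; have h' : tgt f = src (gid G p) by rewrite gid_src.
by rewrite -(cmpE h') gcomp1r.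
Qed.

Lemma cmpV f : cmp f (ginv f) = gid G (src f).
Proof.
have h : tgt f = src (ginv f) by rewrite ginv_src.
by rewrite -(cmpE h) gcompV.
Qed.

Lemma cmpVl f : cmp (ginv f) f = gid G (tgt f).
Proof.
have h : tgt (ginv f) = src f by rewrite ginv_tgt.
by rewrite -(cmpE h) gcompVl.
Qed.

Lemma cmpK f g : tgt f = src g -> cmp (ginv f) (cmp f g) = g.
Proof.
move=> h; rewrite -cmpA ?ginv_tgt // cmpVl.
by rewrite cmp1l.
Qed.

Section Left.
Variables (E : Type) (p : E -> P) (L : left_action G p).

Definition la g (e : E) : E :=
  if pselect (tgt g = p e) is left h then L g e h else e.

Lemma laE g e h : L g e h = la g e.
Proof. by rewrite /la; case: pselect => // h'; apply: lact_cong. Qed.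

Lemma la_base g e : tgt g = p e -> p (la g e) = src g.
Proof. by move=> h; rewrite -(laE h) lact_src. Qed.

Lemma la_cmp f g e : tgt f = src g -> tgt g = p e ->
  la (cmp f g) e = la f (la g e).
Proof.
move=> h3 h1.
have h2 : tgt f = p (L g e h1) by rewrite lact_src.
have h4 : tgt (gcomp f g h3) = p e by rewrite gcomp_tgt.
by have := lactM L h1 h2 h3 h4; rewrite !laE !cmpE.
Qed.

Lemma la1 q e : p e = q -> la (gid G q) e = e.
Proof.
move=> h; have h' : tgt (gid G q) = p e by rewrite gid_tgt.
by rewrite -(laE h') lact1.
Qed.

Lemma laK g e : tgt g = p e -> la (ginv g) (la g e) = e.
Proof.
by move=> h; rewrite -la_cmp ?ginv_tgt // cmpVl la1.
Qed.

Lemma laVK g e : src g = p e -> la g (la (ginv g) e) = e.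
Proof.
by move=> h; rewrite -la_cmp ?ginv_src ?ginv_tgt // cmpV la1.
Qed.

Lemma la_inj g e e' : tgt g = p e -> tgt g = p e' -> la g e = la g e' -> e = e'.
Proof. by move=> h h' /(congr1 (la (ginv g))); rewrite !laK. Qed.
End Left.

Section Right.
Variables (E : Type) (p : E -> P) (R : right_action G p).

Definition ra (e : E) g : E :=
  if pselect (p e = src g) is left h then R e g h else e.

Lemma raE g e h : R e g h = ra e g.
Proof. by rewrite /ra; case: pselect => // h'; apply: ract_cong. Qed.

Lemma ra_base g e : p e = src g -> p (ra e g) = tgt g.
Proof. by move=> h; rewrite -(raE h) ract_tgt. Qed.
End Right.
End TotalOperations.

(** * Calculus in a braided groupoid *)

Section BraidedGroupoid.
Variables (P : Type) (G : braided_groupoid P).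
Implicit Types f g h : G.
Notation L := (la (up_l G)).
Notation R := (ra (up_r G)).
Notation Ld := (la (dn_l G)).
Notation Rd := (ra (dn_r G)).

Lemma L_src g h : tgt g = src h -> src (L g h) = src g.
Proof. exact: la_base. Qed.

Lemma R_tgt g h : tgt g = src h -> tgt (R g h) = tgt h.
Proof. exact: ra_base. Qed.

Lemma L_tgt g h : tgt g = src h -> tgt (L g h) = src (R g h).
Proof. by move=> e; rewrite -(laE _ e) -(raE _ e) up_mid. Qed.

Lemma cmp_braid g h : tgt g = src h -> cmp g h = cmp (L g h) (R g h).
Proof.
by move=> e; have := bg_comm G e (up_mid e); rewrite !cmpE laE raE.
Qed.

(** Since [g h = (L g h)(R g h)], the right action is determined by the left one and the product; a
    groupoid morphism preserving [L] therefore preserves [R]. *)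
Lemma R_LE g h : tgt g = src h -> R g h = cmp (ginv (L g h)) (cmp g h).
Proof. by move=> e; rewrite (cmp_braid e) cmpK // L_tgt. Qed.

Lemma L_cmp g h k : tgt g = src h -> tgt h = src k ->
  L g (cmp h k) = cmp (L g h) (L (R g h) k).
Proof.
move=> h3 h1.
have h2 : tgt g = src (gcomp h k h1) by rewrite gcomp_src.
have h4 : tgt (up_r G g h h3) = src k by rewrite ract_tgt.
have h5 : tgt (up_l G g h h3) = src (up_l G (up_r G g h h3) k h4).
  by rewrite lact_src up_mid.
have := mplM (bg_mp G) h1 h2 h3 h4 h5.
by rewrite -/(up_l G) -/(up_r G) laE !cmpE !laE !raE.
Qed.

Lemma L_id g p : tgt g = p -> L g (gid G p) = gid G (src g).
Proof.
move=> h; have h' : tgt g = src (gid G p) by rewrite gid_src.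
by rewrite -(laE _ h') /up_l mpl1.
Qed.

(** Left-right reflection of the square with left side [g] and bottom [h]; it reduces questions
    about [ginv h] to questions about [h]. *)
Lemma LR_inv g h : tgt g = src h ->
  L (R g h) (ginv h) = ginv (L g h) /\ R (R g h) (ginv h) = g.
Proof.
move=> e.
have h1 : tgt (up_r G g h e) = src (ginv h) by rewrite ract_tgt ginv_src.
have := mplV (M := bg_mp G) h1 h1; rewrite -/(up_l G) -/(up_r G).
by rewrite (laE _ h1) (raE _ h1) !laE !raE.
Qed.

Lemma Ld_LR g h : tgt g = src h -> Ld (L g h) (R g h) = g.
Proof. by move=> e; have [+ _] := up_dn (up_mid e); rewrite !laE raE. Qed.

Lemma Ld_inv_L g h : tgt g = src h -> Ld (ginv (L g h)) g = R g h.
Proof. by move=> e; rewrite -{2}(Ld_LR e) laK // L_tgt. Qed.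

Lemma RdE g h : tgt g = src h -> Rd g h = ginv (L (ginv h) (ginv g)).
Proof.
by move=> e; rewrite -(raE _ e) /= /mpi_rfun -/(up_l G) laE.
Qed.

Lemma dgroupoid_comp1 (X Y : dgroupoid G) (e : tgt X = src Y) :
  (sval (gcomp X Y e)).1 = cmp (sval X).1 (L (sval X).2 (sval Y).1).
Proof. by rewrite /= cmpE -/(up_l G) laE. Qed.

Lemma dgroupoid_comp2 (X Y : dgroupoid G) (e : tgt X = src Y) :
  (sval (gcomp X Y e)).2 = cmp (R (sval X).2 (sval Y).1) (sval Y).2.
Proof. by rewrite /= cmpE -/(up_r G) raE. Qed.
End BraidedGroupoid.

(** * The two actions of a representation and of its double *)

Section RepresentationActions.
Variables (P : Type) (G : braided_groupoid P) (A : quiver P).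
Variable r : representation (dbl_mp G) A.
Notation L := (la (up_l G)).
Notation R := (ra (up_r G)).
Notation Ld := (la (dn_l G)).
Notation Rd := (ra (dn_r G)).
Notation up := (la (up_act r)).
Notation dn := (la (dn_act r)).
Notation upD := (la (up_act (rep_double r))).
Notation dnD := (la (dn_act (rep_double r))).
Notation val := (rep_val r).
Implicit Types (g h : G) (a b x y : A).

Lemma rep_val_la g b : tgt g = src b -> val (up g b) = L g (val b).
Proof.
move=> h; have h' : tgt g = src (val b) by rewrite qfun_src.
by have := rep_val_up h h'; rewrite !laE.
Qed.

Lemma rep_val_la_dn g b : tgt g = src b -> val (dn g b) = Ld g (val b).
Proof.
move=> h; have h' : tgt g = src (val b) by rewrite qfun_src.
by have := rep_val_dn h h'; rewrite !laE.
Qed.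

(** In the diagonal groupoid [(g, k) = (g, id)(id, k)], so its action is recovered from the two
    actions of [G]. *)
Lemma rep_act_pair (X : dgroupoid G) b (h : tgt X = src b) :
  r X b h = dn (sval X).1 (up (sval X).2 b).
Proof.
case: X h => -[g k] hX h; pose hX' : tgt g = src k := hX.
have e1 : tgt k = src b := h.
have e2 : tgt g = src (up_act r k b e1) by rewrite lact_src.
rewrite -(laE _ e1) -(laE _ e2) /= /dn_actfun /up_actfun.
have h3 : tgt (emb_dn g) = src (emb_up k) by rewrite emb_dn_tgt emb_up_src.
have h4 : tgt (gcomp (emb_dn g) (emb_up k) h3) = src b by rewrite gcomp_tgt.
rewrite (lactM r (k := emb_up k) _ _ h3 h4); apply: lact_cong => //.
have h5 : tgt g = src (gid G (src k)) by rewrite gid_src.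
have h6 : tgt (gid G (tgt g)) = src k by rewrite gid_tgt.
change (qpair hX' = @diag_comp _ _ _ (bg_mp G) (emb_dn g) (emb_up k) h3).
apply: qpair_cong.
  rewrite -[LHS](gcomp1r h5); apply: gcomp_cong => //.
  by rewrite lact1.
rewrite -[LHS](gcomp1l h6); apply: gcomp_cong => //.
by rewrite mpr1 gid_tgt hX'.
Qed.

(** Both sides are the action of [(id, h)(g, id)], a product which the diagonal groupoid evaluates
    to [(L h g, R h g)]. *)
Lemma up_dn_comm h g b : tgt h = src g -> tgt g = src b ->
  up h (dn g b) = dn (L h g) (up (R h g) b).
Proof.
move=> hg gb.
have e3 : tgt (emb_up h) = src (emb_dn g) by [].
have e4 : tgt (gcomp (emb_up h) (emb_dn g) e3) = src b.
  by rewrite gcomp_tgt emb_dn_tgt.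
have e1 : tgt (emb_dn g) = src b by rewrite emb_dn_tgt.
have e2 : tgt (emb_up h) = src (r (emb_dn g) b e1) by rewrite lact_src.
have := lactM r e1 e2 e3 e4; rewrite !rep_act_pair /=.
rewrite (la1 (up_act r)) ?gb //.
rewrite (la1 (dn_act r)); last by rewrite la_base // la_base // gb.
move=> ->; rewrite !cmpE laE raE; congr (dn _ _).
  by rewrite cmp1l // L_src.
by rewrite cmp1r // R_tgt.
Qed.

Lemma upD_inl g b : tgt g = src b -> upD g (inl b) = inl (up g b).
Proof.
move=> h; have h' : tgt g = src (inl b : qdouble A) by [].
by rewrite -(laE _ h') -(laE _ h); congr inl; apply: lact_cong.
Qed.

Lemma dnD_inl g b : tgt g = src b -> dnD g (inl b) = inl (dn g b).
Proof.
move=> h; have h' : tgt g = src (inl b : qdouble A) by [].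
by rewrite -(laE _ h') -(laE _ h); congr inl; apply: lact_cong.
Qed.

(** The right action of [G] on the diagonal groupoid keeps the form [(id, g)], so the defining
    formula on inverse arrows stays within the action [up]. *)
Lemma upD_inr g b : tgt g = tgt b ->
  upD g (inr b) = inr (up (R g (ginv (val b))) b).
Proof.
move=> h; have h' : tgt g = src (inr b : qdouble A) by [].
have e1 : tgt g = src (ginv (val b)) by rewrite ginv_src qfun_tgt.
have e2 : tgt (up_r G g (ginv (val b)) e1) = src b.
  by rewrite ract_tgt ginv_tgt qfun_src.
rewrite -(laE _ h') -(raE _ e1) -(laE _ e2); congr inr; apply: lact_cong => //.
apply: qpair_cong; last exact: ract_cong.
rewrite /= -(up_mid e1); apply: etrans (mpr1 (mp_inverse (bg_mp G)) _) _.
by congr gid; congr tgt; apply: lact_cong.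
Qed.

Lemma dnD_inr g b : tgt g = tgt b ->
  dnD g (inr b) = inr (dn (Rd g (ginv (val b))) b).
Proof.
move=> h; have h' : tgt g = src (inr b : qdouble A) by [].
have e1 : tgt g = src (ginv (val b)) by rewrite ginv_src qfun_tgt.
have e2 : tgt (dn_r G g (ginv (val b)) e1) = src b.
  by rewrite ract_tgt ginv_tgt qfun_src.
rewrite -(laE _ h') -(raE _ e1) -(laE _ e2); congr inr; apply: lact_cong => //.
apply: qpair_cong; first by apply: ract_cong => //; rewrite lact1.
by rewrite /up_r mpr1 ract_tgt.
Qed.
End RepresentationActions.

(** * The braiding of a representation *)

Section Box.
Variables (P : Type) (A : quiver P) (s : qmor (qprod A A) (qprod A A)).
Implicit Types x y z u v w : A.

(* sigma(x, y) = (u, v), pictured as a square with left side x, bottom y, top u and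
   right side v. *)
Definition box x y u v : Prop :=
  exists h : tgt x = src y, qleft s h = u /\ qright s h = v.

Lemma box_sigma x y (h : tgt x = src y) : box x y (qleft s h) (qright s h).
Proof. by exists h. Qed.

Lemma box_fun x y u v u' v' : box x y u v -> box x y u' v' -> u = u' /\ v = v'.
Proof.
by case=> h [<- <-] [h' [<- <-]]; rewrite (Prop_irrelevance h h').
Qed.

Lemma box_ends x y u v : box x y u v ->
  [/\ tgt x = src y, src u = src x, tgt u = src v & tgt v = tgt y].
Proof.
case=> h [<- <-]; split => //.
- exact: (qfun_src s (qpair h)).
- exact: (qprodP (s (qpair h))).
- exact: (qfun_tgt s (qpair h)).
Qed.

Lemma box_total x y : tgt x = src y -> exists u v, box x y u v.
Proof. by move=> h; exists (qleft s h), (qright s h); apply: box_sigma. Qed.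

(** Nested composable pairs are flattened so that, by [tri_inj], domain proofs disappear from
    equalities between them. *)
Definition tri (t : qprod (qprod A A) A) : A * A * A :=
  ((sval (sval t).1).1, (sval (sval t).1).2, (sval t).2).

Lemma tri_inj : injective tri.
Proof.
move=> [[[[x y] h] z] h'] [[[[x' y'] k] z'] k'] [/= ex ey ez].
apply: eq_exist; congr pair => //; apply: eq_exist.
by rewrite ex ey.
Qed.

Definition sigma12 : qprod (qprod A A) A -> qprod (qprod A A) A :=
  qprod_map s (qid A).
Definition sigma23 (t : qprod (qprod A A) A) : qprod (qprod A A) A :=
  qassocV (qprod_map (qid A) s (qassoc t)).

Lemma tri_sigma12 t x y z u v :
  tri t = (x, y, z) -> box x y u v -> tri (sigma12 t) = (u, v, z).
Proof.
case: t => -[[[x' y'] h] z'] h' [ex ey ez] [k [<- <-]].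
rewrite /= in ex ey ez; subst x' y' z'.
by have e : h = k := Prop_irrelevance h k; subst h.
Qed.

Lemma tri_sigma23 t x y z u v :
  tri t = (x, y, z) -> box y z u v -> tri (sigma23 t) = (x, u, v).
Proof.
case: t => -[[[x' y'] h] z'] h' [ex ey ez] [k [<- <-]].
rewrite /= in ex ey ez; subst x' y' z'.
set t : qprod (qprod A A) A := exist _ _ _.
have e : qpair (A := A) (B := A) (qprodP t) = qpair k.
  exact: qpair_cong.
by rewrite /tri /= /qleft /qright -e.
Qed.

(** Each side of the braid equation runs through three boxes: the first three belong to
    [s12 s23 s12], the last three to [s23 s12 s23]. Together the six are the faces of a cube. *)
Lemma braid_equationP : braid_equation s <->
  forall x y z u v w z' x1 w' y1 z1 x1' x2 w'' z'',
    box x y u v -> box v z w z' -> box u w x1 w' ->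
    box y z y1 z1 -> box x y1 x1' x2 -> box x2 z1 w'' z'' ->
    (x1, w', z') = (x1', w'', z'').
Proof.
split=> [E x y z u v w z' x1 w' y1 z1 x1' x2 w'' z'' b1 b2 b3 b4 b5 b6|E].
  have [hxy _ _ _] := box_ends b1; have [hyz _ _ _] := box_ends b4.
  have h : tgt (qpair hxy) = src z by [].
  have e : tri (qpair h) = (x, y, z) by [].
  rewrite -(tri_sigma12 (tri_sigma23 (tri_sigma12 e b1) b2) b3).
  rewrite -(tri_sigma23 (tri_sigma12 (tri_sigma23 e b4) b5) b6).
  by congr tri; apply: E.
suff S t : sigma12 (sigma23 (sigma12 t)) = sigma23 (sigma12 (sigma23 t)).
  exact: S.
case et : (tri t) => [[x y] z].
have hxy : tgt x = src y.
  by case: et => <- <- _; apply: (qprodP (sval t).1).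
have hyz : tgt y = src z by case: et => _ <- <-; apply: (qprodP t).
have [u [v b1]] := box_total hxy; have [_ _ huv hv] := box_ends b1.
have [w [z' b2]] : exists w z', box v z w z' by apply: box_total; rewrite hv.
have [_ hw hwz hz'] := box_ends b2.
have [x1 [w' b3]] : exists x1 w', box u w x1 w' by apply: box_total; rewrite hw.
have [y1 [z1 b4]] := box_total hyz; have [_ hy1 hyz1 hz1] := box_ends b4.
have [x1' [x2 b5]] : exists x1 x2, box x y1 x1 x2 by apply: box_total; rewrite hy1.
have [_ _ _ hx2] := box_ends b5.
have [w'' [z'' b6]] : exists w z, box x2 z1 w z by apply: box_total; rewrite hx2.
apply: tri_inj.
transitivity (x1, w', z').
  exact: (tri_sigma12 (tri_sigma23 (tri_sigma12 et b1) b2) b3).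
rewrite (E _ _ _ _ _ _ _ _ _ _ _ _ _ _ _ b1 b2 b3 b4 b5 b6).
exact/esym/(tri_sigma23 (tri_sigma12 (tri_sigma23 et b4) b5) b6).
Qed.
End Box.

(** * The boxes of a representation *)

Section RepresentationBox.
Variables (P : Type) (G : braided_groupoid P) (A : quiver P).
Variable r : representation (dbl_mp G) A.
Notation L := (la (up_l G)).
Notation R := (ra (up_r G)).
Notation up := (la (up_act r)).
Notation dn := (la (dn_act r)).
Notation upD := (la (up_act (rep_double r))).
Notation dnD := (la (dn_act (rep_double r))).
Notation val := (rep_val r).
Implicit Types (g h : G) (x y z u v : A).

Definition rep_box x y u v : Prop :=
  [/\ tgt x = src y, u = up (val x) y & v = dn (ginv (val u)) x].

Lemma rep_left_la x y (h : tgt x = src y) : rep_left r h = up (val x) y.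
Proof. exact: laE. Qed.

Lemma rep_right_la x y (h : tgt x = src y) :
  rep_right r h = dn (ginv (val (up (val x) y))) x.
Proof. by rewrite /rep_right laE rep_left_la. Qed.

Lemma rep_boxE x y (h : tgt x = src y) : rep_box x y (rep_left r h) (rep_right r h).
Proof. by rewrite /rep_box rep_right_la rep_left_la. Qed.

Section BoxFacts.
Variables x y u v : A.
Hypothesis b : rep_box x y u v.

Let hxy : tgt x = src y. Proof. by case: b. Qed.
Let hX : tgt (val x) = src y. Proof. by rewrite qfun_tgt. Qed.
Let hXY : tgt (val x) = src (val y). Proof. by rewrite qfun_tgt qfun_src. Qed.

Lemma rep_box_val_left : val u = L (val x) (val y).
Proof. by case: b => _ -> _; rewrite rep_val_la. Qed.

Lemma rep_box_src : src u = src x.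
Proof. by case: b => _ -> _; rewrite (la_base (up_act r)) // qfun_src. Qed.

Lemma rep_box_right_src : src v = tgt u.
Proof.
case: b => _ eu ->; rewrite (la_base (dn_act r)) ?ginv_src ?qfun_tgt //.
by rewrite ginv_tgt qfun_src -rep_box_src.
Qed.

Lemma rep_box_val_right : val v = R (val x) (val y).
Proof.
case: (b) => _ _ ->; rewrite rep_val_la_dn; last first.
  by rewrite ginv_tgt qfun_src rep_box_src.
by rewrite rep_box_val_left Ld_inv_L.
Qed.

Lemma rep_box_tgt : tgt v = tgt y.
Proof. by rewrite -(qfun_tgt val) rep_box_val_right R_tgt // qfun_tgt. Qed.

Lemma rep_box_dn : dn (val u) v = x.
Proof. by case: b => _ _ ->; rewrite (laVK (dn_act r)) // qfun_src rep_box_src. Qed.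

(** With the next three lemmas, this expresses a box through the actions on the double, one formula
    for each side whose letter acts. The four clauses of [letter] below copy these formulas. *)
Lemma rep_box_upD_inl : upD (val x) (inl y) = inl u.
Proof. by rewrite upD_inl //; case: b => _ ->. Qed.

Lemma rep_box_dnD_inl : dnD (val u) (inl v) = inl x.
Proof. by rewrite dnD_inl ?rep_box_dn // qfun_tgt rep_box_right_src. Qed.

Lemma rep_box_upD_inr : upD (val v) (inr y) = inr u.
Proof.
rewrite upD_inr; last by rewrite qfun_tgt rep_box_tgt.
rewrite rep_box_val_right; have [_ ->] := LR_inv hXY.
by case: b => _ ->.
Qed.

Lemma rep_box_dnD_inr : dnD (val y) (inr v) = inr x.
Proof.
(* The inverse formula is the accessible one: by [RdE], the element acting on [x] is the inverse of
   [L |x| |y| = |u|], and [dn |u|^-1 x] is [v]. *)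
have e : dnD (ginv (val y)) (inr x) = inr v.
  rewrite dnD_inr; last by rewrite ginv_tgt qfun_src.
  rewrite RdE; last by rewrite ginv_tgt ginv_src.
  by rewrite !ginvK -rep_box_val_left; case: b => _ _ ->.
by rewrite -e (laVK (dn_act _)) // qfun_src.
Qed.
End BoxFacts.
End RepresentationBox.

(** * The non-degenerate braiding of a representation *)

Section RepresentationNDBraiding.
Variables (P : Type) (G : braided_groupoid P) (A : quiver P).
Variable r : representation (dbl_mp G) A.
Notation L := (la (up_l G)).
Notation up := (la (up_act r)).
Notation dn := (la (dn_act r)).
Notation dnD := (la (dn_act (rep_double r))).
Notation val := (rep_val r).
Implicit Types (x y z u v w : A).

Lemma rep_box_cmp x y u v : rep_box r x y u v ->
  cmp (val x) (val y) = cmp (val u) (val v).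
Proof.
move=> b; have h : tgt (val x) = src (val y).
  by case: b => h _ _; rewrite qfun_tgt qfun_src.
by rewrite (rep_box_val_left b) (rep_box_val_right b) cmp_braid.
Qed.

(** The first components agree because [|x||y| = |u||v|] acts on [z]; the second by the exchange
    rule [up_dn_comm]; the third because one and the same element of [G] carries both [z'] and [z'']
    to [x] under [dn]. *)
Lemma rep_braid x y z u v w z' x1 w' y1 z1 x1' x2 w'' z'' :
  rep_box r x y u v -> rep_box r v z w z' -> rep_box r u w x1 w' ->
  rep_box r y z y1 z1 -> rep_box r x y1 x1' x2 -> rep_box r x2 z1 w'' z'' ->
  (x1, w', z') = (x1', w'', z'').
Proof.
move=> b1 b2 b3 b4 b5 b6.
have e12 : tgt (val x) = src y by case: b1; rewrite qfun_tgt.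
have e23 : tgt (val y) = src z by case: b4; rewrite qfun_tgt.
have e23' : tgt (val v) = src z by case: b2; rewrite qfun_tgt.
have e12' : tgt (val u) = src (val v).
  by rewrite qfun_tgt qfun_src (rep_box_right_src b1).
have exy1 : tgt (val x) = src (val y1).
  by rewrite qfun_tgt qfun_src; case: b5.
have e1 : x1 = x1'.
  have [_ -> _] := b3; have [_ -> _] := b5.
  have [_ -> _] := b2; have [_ -> _] := b4.
  rewrite -!(la_cmp (up_act r)) //; last by rewrite qfun_tgt qfun_src; case: b1.
  by rewrite -(rep_box_cmp b1).
have e2 : w' = w''.
  have [_ _ ->] := b3; have [_ -> _] := b6; have [_ _ ->] := b4.
  rewrite up_dn_comm; first last.
  - by rewrite ginv_tgt qfun_src (rep_box_src b4).
  - by rewrite ginv_src !qfun_tgt (rep_box_tgt b5).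
  rewrite (rep_box_val_right b5); have [-> ->] := LR_inv exy1.
  by rewrite -(rep_box_val_left b5) e1; have [_ -> _] := b1.
have e3 : z' = z''.
  have h1 : tgt (val w) = src z'.
    by rewrite qfun_tgt (rep_box_right_src b2).
  have h2 : tgt (val w'') = src z''.
    by rewrite qfun_tgt (rep_box_right_src b6).
  have h3 : tgt (val u) = src (val w).
    by rewrite qfun_tgt qfun_src; case: b3.
  have h4 : tgt (val x1') = src (val w'').
    by rewrite qfun_tgt qfun_src (rep_box_src b6) (rep_box_right_src b5).
  have E : cmp (val u) (val w) = cmp (val x1') (val w'').
    by rewrite (rep_box_cmp b3) e1 e2.
  have E1 : dn (cmp (val u) (val w)) z' = x.
    by rewrite la_cmp // (rep_box_dn b2) (rep_box_dn b1).
  have E2 : dn (cmp (val x1') (val w'')) z'' = x.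
    by rewrite la_cmp // (rep_box_dn b6) (rep_box_dn b5).
  apply: (la_inj (L := dn_act r) (g := cmp (val u) (val w))).
  - by rewrite tgt_cmp.
  - by rewrite E tgt_cmp.
  - by rewrite E1 E E2.
by rewrite e1 e2 e3.
Qed.

Lemma rep_box_inv x y u v : rep_box r x y u v ->
  x = dn (val u) v /\ y = up (ginv (val x)) u.
Proof.
move=> b; rewrite (rep_box_dn b); split=> //.
by case: b => h -> _; rewrite (laK (up_act r)) // qfun_tgt.
Qed.

Lemma rep_box_corner u v : tgt u = src v -> exists x y, rep_box r x y u v.
Proof.
move=> h; pose x := dn (val u) v; exists x, (up (ginv (val x)) u).
have h' : tgt (val u) = src v by rewrite qfun_tgt.
have sx : src x = src u by rewrite /x la_base // qfun_src.
have h2 : tgt (ginv (val x)) = src u by rewrite ginv_tgt qfun_src.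
split; first by rewrite (la_base (up_act r)) // ginv_src qfun_tgt.
  by rewrite (laVK (up_act r)) // qfun_src.
by rewrite (laK (dn_act r)).
Qed.

Lemma rep_box_fun x y u v u' v' :
  rep_box r x y u v -> rep_box r x y u' v' -> u = u' /\ v = v'.
Proof. by case=> _ -> -> [_ -> ->]. Qed.

Lemma rep_braiding_mid (p : qprod A A) :
  tgt (rep_left r (qprodP p)) = src (rep_right r (qprodP p)).
Proof. by rewrite -(rep_box_right_src (rep_boxE r (qprodP p))). Qed.

Definition rep_braiding : qmor (qprod A A) (qprod A A) :=
  @QMor P (qprod A A) (qprod A A) (fun p => qpair (rep_braiding_mid p))
    (fun p => rep_box_src (rep_boxE r (qprodP p)))
    (fun p => rep_box_tgt (rep_boxE r (qprodP p))).

Lemma rep_braidingE x y (h : tgt x = src y) :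
  qleft rep_braiding h = rep_left r h /\ qright rep_braiding h = rep_right r h.
Proof.
split; first by rewrite /qleft /= /rep_left; apply: lact_cong.
by rewrite /qright /= !rep_right_la.
Qed.

Lemma box_rep_braiding x y u v : box rep_braiding x y u v <-> rep_box r x y u v.
Proof.
split=> [[h [<- <-]]|b].
  by have [-> ->] := rep_braidingE h; apply: rep_boxE.
have [h _ _] := b; exists h; have [-> ->] := rep_braidingE h.
by have [-> ->] := rep_box_fun (rep_boxE r h) b.
Qed.

Lemma rep_braiding_braid : braid_equation rep_braiding.
Proof.
apply/braid_equationP => x y z u v w z' x1 w' y1 z1 x1' x2 w'' z''.
move=> /box_rep_braiding b1 /box_rep_braiding b2 /box_rep_braiding b3.
move=> /box_rep_braiding b4 /box_rep_braiding b5 /box_rep_braiding b6.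
exact: rep_braid b1 b2 b3 b4 b5 b6.
Qed.

Lemma rep_braiding_bij : bijective rep_braiding.
Proof.
apply: inj_surj_bij => [p q e|p].
  have bp := rep_boxE r (qprodP p); have bq := rep_boxE r (qprodP q).
  have [e1 e2] := congr1 sval e.
  rewrite -e1 -e2 in bq.
  have [x1 y1] := rep_box_inv bp; have [x2 y2] := rep_box_inv bq.
  have ex : (sval p).1 = (sval q).1 by exact: etrans x1 (esym x2).
  have ey : (sval p).2 = (sval q).2.
    by apply: etrans y1 (etrans _ (esym y2)); congr (up (ginv (val _)) _).
  by rewrite (qpairE p) (qpairE q); apply: qpair_cong.
have [x [y b]] := rep_box_corner (qprodP p).
have [h _ _] := b; exists (qpair h); rewrite [RHS]qpairE.
have [e1 e2] := rep_box_fun (rep_boxE r (qprodP (qpair h))) b.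
exact: qpair_cong.
Qed.

Lemma qleft_rep x y (h : tgt x = src y) : qleft rep_braiding h = up (val x) y.
Proof. by rewrite (rep_braidingE h).1 rep_left_la. Qed.

Lemma rep_braiding_nd : nondegenerate rep_braiding.
Proof.
move=> x; split; apply: inj_surj_bij.
- move=> [y hy] [y' hy'] /(congr1 sval) /=.
  rewrite !qleft_rep => e; apply: eq_exist.
  by apply: (la_inj (L := up_act r) (g := val x)) => //; rewrite qfun_tgt.
- move=> [u hu].
  have h : tgt (ginv (val x)) = src u by rewrite ginv_tgt qfun_src.
  have hy : src (up (ginv (val x)) u) = tgt x.
    by rewrite (la_base (up_act r)) // ginv_src qfun_tgt.
  exists (mkfiber hy); apply: eq_exist => /=.
  by rewrite qleft_rep (laVK (up_act r)) // qfun_src.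
- move=> [y hy] [y' hy'] /(congr1 sval) /=.
  rewrite !(rep_braidingE _).2 !rep_right_la => e; apply: eq_exist.
  have := rep_box_dnD_inr (rep_boxE r hy); rewrite rep_right_la e.
  by rewrite -rep_right_la (rep_box_dnD_inr (rep_boxE r hy')) => -[].
move=> [v hv].
have hx : tgt (val x) = src (inr v : qdouble A) by rewrite qfun_tgt /= hv.
(* Here [x] is the bottom side and [v] the right one. By [rep_box_dnD_inr], the missing left side
   must be the result of [|x|] acting on the inverse of [v]. *)
case ey : (dnD (val x) (inr v)) => [y|y].
  by rewrite dnD_inr // in ey.
have hy : @tgt P A y = src x.
  have := la_base (dn_act (rep_double r)) hx; rewrite ey qfun_src. exact.
exists (mkfiber hy); apply: eq_exist => /=.
rewrite (rep_braidingE _).2.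
have := rep_box_dnD_inr (rep_boxE r hy); rewrite -ey => e.
suff: inr (rep_right r hy) = inr v :> qdouble A.
  by case=> <-; rewrite !rep_right_la.
apply: la_inj e => //.
by rewrite qfun_tgt /= (rep_box_tgt (rep_boxE r hy)).
Qed.

Definition rep_nd_braiding : nd_braiding A :=
  NDBraiding rep_braiding_bij rep_braiding_braid rep_braiding_nd.
End RepresentationNDBraiding.

(** * Structural pairs are determined by their braiding *)

Lemma sval_inj (T : Type) (Q : T -> Prop) : injective (@sval T Q).
Proof. by move=> [x px] [y py] /= e; apply: eq_exist. Qed.

(** Comparing arrows of [aut] as relations on [E] avoids transport between fibres over base points
    that are only provably equal. *)
Definition aut_graph (E P : Type) (p : E -> P) (a : aut_arrow p) (e e' : E) : Prop :=
  exists h : p e = aut_tgt a, sval (aut_map (mkfiber h)) = e'.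

Lemma aut_arrow_eq (E P : Type) (p : E -> P) (a a' : aut_arrow p) :
  aut_src a = aut_src a' -> aut_tgt a = aut_tgt a' ->
  (forall e e', aut_graph a e e' -> aut_graph a' e e') -> a = a'.
Proof.
case: a a' => [s t f fb] [s' t' f' fb'] /= es et; subst s' t' => H.
have ef : f = f'.
  apply/funext => -[e h]; apply: sval_inj.
  have [|h' /= <-] := H e (sval (f (mkfiber h))); first by exists h.
  by congr (sval (f' _)); apply: eq_exist.
by subst f'; congr AutArrow; apply: Prop_irrelevance.
Qed.

Lemma aut_graph_action (P : Type) (G : groupoid P) (E : Type) (p : E -> P)
    (L : left_action G p) g e e' :
  aut_graph (action_aut L g) e e' <-> p e = tgt g /\ la L g e = e'.
Proof.
split=> [[h /= <-]|[h <-]]; first by rewrite laE.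
by exists h; rewrite /= laE.
Qed.

Lemma action_aut_eq (P : Type) (G : groupoid P) (E : Type) (p : E -> P)
    (L : left_action G p) g g' :
  action_aut L g = action_aut L g' <->
  [/\ src g = src g', tgt g = tgt g' &
      forall e, tgt g = p e -> la L g e = la L g' e].
Proof.
split=> [E0|[es et H]].
  have et := congr1 (@aut_tgt _ _ _) E0.
  split=> //; first exact: (congr1 (@aut_src _ _ _) E0).
  move=> e h; have : aut_graph (action_aut L g') e (la L g e).
    by rewrite -E0; apply/aut_graph_action.
  by case/aut_graph_action.
apply: aut_arrow_eq => // e e' /aut_graph_action [h <-].
by apply/aut_graph_action; rewrite -et h H.
Qed.

(** * Injectivity of [nabla] as joint faithfulness *)

Section Nabla.
Variables (P : Type) (G : braided_groupoid P) (B : quiver P).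
Variable r : representation (dbl_mp G) B.
Notation R := (ra (up_r G)).
Notation up := (la (up_act r)).
Notation dn := (la (dn_act r)).
Notation val := (rep_val r).

Lemma pair_act_la g x y (h : tgt x = src y) : tgt g = src x ->
  sval (la (pair_act r) g (qpair h)) = (up g x, dn (R g (val x)) y).
Proof.
move=> hg; have hg' : tgt g = src (qpair h) by [].
rewrite -(laE _ hg'); congr pair; first exact: (laE (up_act r)).
by apply: etrans (laE (dn_act r) _) _; rewrite raE.
Qed.

(** [R_LE] writes the acting element as [|up g x|^-1 g |x|], which exposes [dn g]. *)
Lemma dn_R g x y : tgt g = src x -> tgt x = src y ->
  dn (R g (val x)) y = dn (ginv (val (up g x))) (dn g (dn (val x) y)).
Proof.
move=> hg h.
have hgx : tgt g = src (val x) by rewrite qfun_src.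
have hx : tgt (val x) = src y by rewrite qfun_tgt.
have h1 : tgt (cmp g (val x)) = src y by rewrite tgt_cmp.
have h2 : tgt (ginv (val (up g x))) = src (cmp g (val x)).
  by rewrite src_cmp ginv_tgt qfun_src la_base.
by rewrite R_LE // -rep_val_la // (la_cmp (dn_act r) h2 h1) (la_cmp (dn_act r) hgx hx).
Qed.

(** Turns injectivity of [nabla] into joint faithfulness of [up] and [dn]. The hypothesis that every
    arrow can be continued holds in a double, where an arrow can be followed by its inverse. *)
Lemma nabla_eq g g' : (forall x : B, exists y : B, tgt x = src y) ->
  nabla r g = nabla r g' <->
  [/\ src g = src g', tgt g = tgt g' &
      forall b, tgt g = src b -> up g b = up g' b /\ dn g b = dn g' b].
Proof.
move=> ext; rewrite /nabla action_aut_eq; split=> -[es et H]; split=> //.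
  have Hu b : tgt g = src b -> up g b = up g' b.
    move=> h; have [y hy] := ext b.
    have := congr1 sval (H (qpair hy) h).
    by rewrite !pair_act_la -?et // => -[].
  move=> b h; split; first exact: Hu.
  (* The pair to test is [b] followed by [dn |b|^-1 b]: since [dn |b|] returns the second entry to
     [b], [dn_R] makes [dn g b] appear in the second component. *)
  have hv : tgt (ginv (val b)) = src b by rewrite ginv_tgt qfun_src.
  have hb : tgt b = src (dn (ginv (val b)) b).
    by rewrite (la_base (dn_act r)) // ginv_src qfun_tgt.
  have := congr1 sval (H (qpair hb) h).
  rewrite !pair_act_la -?et // => -[_].
  rewrite !dn_R -?et // (laVK (dn_act r)) ?qfun_src // Hu //.
  apply: la_inj; rewrite ginv_tgt qfun_src (la_base (up_act r)) -?et //.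
  - by rewrite (la_base (dn_act r)).
  - by rewrite (la_base (dn_act r)) -?et.
move=> p h; rewrite [p]qpairE.
have e1 : tgt g = src (sval p).1 by [].
have e2 : tgt (val (sval p).1) = src (sval p).2.
  by rewrite qfun_tgt; apply: qprodP.
apply: sval_inj; rewrite !pair_act_la -?et //.
have [-> _] := H _ e1; congr pair.
rewrite !dn_R -?et //; [|exact: qprodP..].
have [-> _] := H _ e1; congr dn; have [] // := H (dn (val (sval p).1) (sval p).2).
by rewrite (la_base (dn_act r)) // qfun_src.
Qed.
End Nabla.

Lemma nd_braiding_eq (P : Type) (A : quiver P) (b b' : nd_braiding A) :
  (forall x y u v, box b x y u v -> box b' x y u v) -> b = b'.
Proof.
move=> H.
have e : b = b' :> qmor _ _.
  have ef : qfun b = qfun b'.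
    apply/funext => p; rewrite [p]qpairE; apply: sval_inj.
    have [h [e1 e2]] := H _ _ _ _ (box_sigma b (qprodP p)).
    move: e1 e2; rewrite /qleft /qright (Prop_irrelevance h (qprodP p)).
    by case: (sval _) (sval _) => [u v] [u' v'] /= -> ->.
  case: (b : qmor _ _) (b' : qmor _ _) ef => [f s t] [f' s' t'] /= ef.
  by subst f'; congr QMor; apply: Prop_irrelevance.
case: b b' e {H} => [s B1 B2 B3] [s' B1' B2' B3'] /= e; subst s'.
by congr NDBraiding; apply: Prop_irrelevance.
Qed.

(** * Elements of two groupoids with the same action *)

Section Agree.
Variables (P : Type) (G G' : groupoid P) (E : Type) (p : E -> P).
Variables (L : left_action G p) (L' : left_action G' p).

Definition agree (g : G) (g' : G') : Prop :=
  [/\ src g = src g', tgt g = tgt g' &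
      forall e, tgt g = p e -> la L g e = la L' g' e].

Lemma agree_id q : agree (gid G q) (gid G' q).
Proof.
split; rewrite ?gid_src ?gid_tgt // => e h.
by rewrite !la1.
Qed.

Lemma agree_inv g g' : agree g g' -> agree (ginv g) (ginv g').
Proof.
case=> es et H; split; rewrite ?ginv_src ?ginv_tgt // => e h.
have h' : tgt (ginv g) = p e by rewrite ginv_tgt.
apply: (la_inj (L := L') (g := g')).
- by rewrite la_base // ginv_src.
- by rewrite la_base ?ginv_src // ginv_tgt -es.
rewrite laVK -?es // -H; last by rewrite la_base // ginv_src.
by rewrite laVK.
Qed.

Lemma agree_cmp f f' g g' : tgt f = src g -> agree f f' -> agree g g' ->
  agree (cmp f g) (cmp f' g').
Proof.
move=> h [es et H] [es2 et2 H2].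
have h' : tgt f' = src g' by rewrite -et -es2.
split; rewrite ?src_cmp ?tgt_cmp // => e he.
by rewrite !la_cmp -?et2 // H ?la_base // H2.
Qed.
End Agree.

Lemma agree_sym (P : Type) (G G' : groupoid P) (E : Type) (p : E -> P)
  (L : left_action G p) (L' : left_action G' p) g g' :
  agree L L' g g' -> agree L' L g' g.
Proof. by case=> es et H; split=> // e h; rewrite H // et. Qed.

Section SameBraiding.
Variables (P : Type) (A : quiver P) (G G' : braided_groupoid P).
Variables (r : representation (dbl_mp G) A) (r' : representation (dbl_mp G') A).
Notation upD := (up_act (rep_double r)).
Notation dnD := (dn_act (rep_double r)).
Notation upD' := (up_act (rep_double r')).
Notation dnD' := (dn_act (rep_double r')).

(** The graph of the isomorphism to be built. It starts as a relation because an image of [g] is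
    found along a word in the generators, and is shown unique only by faithfulness. *)
Definition theta g g' : Prop := agree upD upD' g g' /\ agree dnD dnD' g g'.

Lemma rep_box_corner_r y v : tgt v = tgt y -> exists x u, rep_box r x y u v.
Proof.
move=> h; have [_ [f _ fK]] := rep_braiding_nd r y.
have := fK (mkfiber h); case: (f _) => x hx /(congr1 sval) /= e.
exists x, (qleft (rep_braiding r) hx); apply/box_rep_braiding.
by exists hx; split=> //; rewrite -e; congr qright; apply: Prop_irrelevance.
Qed.

Hypothesis same : forall x y u v, rep_box r x y u v -> rep_box r' x y u v.

(** In each of the four cases the letter [a] and the arrow acted on are adjacent sides of a box;
    completing it and applying the box formula in both structures gives the same result. *)
Lemma theta_val a : theta (rep_val r a) (rep_val r' a).
Proof.
split; split; rewrite ?qfun_src ?qfun_tgt // => -[b|b] h.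
- have B := rep_boxE r h.
  by rewrite (rep_box_upD_inl B) (rep_box_upD_inl (same B)).
- have [x [u B]] := rep_box_corner_r h.
  by rewrite (rep_box_upD_inr B) (rep_box_upD_inr (same B)).
- have [x [y B]] := rep_box_corner r h.
  by rewrite (rep_box_dnD_inl B) (rep_box_dnD_inl (same B)).
have [x [u B]] := rep_box_corner_r (esym h).
by rewrite (rep_box_dnD_inr B) (rep_box_dnD_inr (same B)).
Qed.

Lemma theta_id q : theta (gid G q) (gid G' q).
Proof. by split; apply: agree_id. Qed.

Lemma theta_inv g g' : theta g g' -> theta (ginv g) (ginv g').
Proof. by case=> *; split; apply: agree_inv. Qed.

Lemma theta_cmp f f' g g' : tgt f = src g -> theta f f' -> theta g g' ->
  theta (cmp f g) (cmp f' g').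
Proof. by move=> h [? ?] [? ?]; split; apply: agree_cmp. Qed.

Hypothesis gen : forall g : G, generated (fun v => exists a, v = rep_val r a) g.

Lemma theta_total g : exists g', theta g g'.
Proof.
elim: (gen g) => [_ [a ->]|q|f _ [f' H]|f k h _ [f' H] _ [k' H']].
- by exists (rep_val r' a); apply: theta_val.
- by exists (gid G' q); apply: theta_id.
- by exists (ginv f'); apply: theta_inv.
by exists (cmp f' k'); rewrite cmpE; apply: theta_cmp.
Qed.

Hypothesis inj' : injective (nabla (rep_double r')).

Lemma theta_fun g g1 g2 : theta g g1 -> theta g g2 -> g1 = g2.
Proof.
move=> [[es et Hu] [_ _ Hd]] [[es' et' Hu'] [_ _ Hd']].
apply: inj'; apply/nabla_eq.
  move=> [a|a]; first by exists (inr a).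
  by exists (inl a).
split; rewrite -?es -?et // => b h.
by rewrite -Hu // -Hu' // -Hd // -Hd'.
Qed.
End SameBraiding.

Lemma theta_sym (P : Type) (A : quiver P) (G G' : braided_groupoid P)
    (r : representation (dbl_mp G) A) (r' : representation (dbl_mp G') A) g g' :
  theta r r' g g' -> theta r' r g' g.
Proof. by case=> *; split; apply: agree_sym. Qed.

Lemma same_box_sym (P : Type) (A : quiver P) (G G' : braided_groupoid P)
    (r : representation (dbl_mp G) A) (r' : representation (dbl_mp G') A) :
  (forall x y u v, rep_box r x y u v -> rep_box r' x y u v) ->
  forall x y u v, rep_box r' x y u v -> rep_box r x y u v.
Proof.
move=> same x y u v B; have [h _ _] := B.
by have [-> ->] := rep_box_fun B (same _ _ _ _ (rep_boxE r h)); apply: rep_boxE.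
Qed.

(** * The isomorphism obtained from equal braidings *)

Section SameBraidingIso.
Variables (P : Type) (A : quiver P) (S S' : structural_pair A).
Notation G := (sp_groupoid S).
Notation G' := (sp_groupoid S').
Hypothesis same : forall x y u v, rep_box S x y u v -> rep_box S' x y u v.

Definition sp_map (g : G) : G' := projT1 (cid (theta_total same (@sp_gen _ _ S) g)).

Lemma sp_map_theta g : theta S S' g (sp_map g).
Proof. by rewrite /sp_map; case: cid. Qed.

Lemma sp_mapE g g' : theta S S' g g' -> sp_map g = g'.
Proof. exact: (theta_fun (@sp_inj _ _ S') (sp_map_theta g)). Qed.

Lemma sp_map_src g : src (sp_map g) = src g.
Proof. by have [[]] := sp_map_theta g. Qed.

Lemma sp_map_tgt g : tgt (sp_map g) = tgt g.
Proof. by have [[]] := sp_map_theta g. Qed.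

Lemma sp_map_bij : bijective sp_map.
Proof.
apply: inj_surj_bij => [g1 g2 e|g'].
  have t1 := theta_sym (sp_map_theta g1).
  have t2 := theta_sym (sp_map_theta g2).
  by apply: (theta_fun (@sp_inj _ _ S) t1); rewrite e.
have [g t] := theta_total (same_box_sym same) (@sp_gen _ _ S') g'.
by exists g; apply: sp_mapE; apply: theta_sym.
Qed.

Lemma sp_map_cmp f g : tgt f = src g -> sp_map (cmp f g) = cmp (sp_map f) (sp_map g).
Proof. by move=> h; apply: sp_mapE; apply: theta_cmp => //; apply: sp_map_theta. Qed.

Lemma sp_map_inv g : sp_map (ginv g) = ginv (sp_map g).
Proof. by apply: sp_mapE; apply: theta_inv; apply: sp_map_theta. Qed.

Lemma sp_map_id q : sp_map (gid G q) = gid G' q.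
Proof. by apply: sp_mapE; apply: theta_id. Qed.

Lemma sp_map_val a : sp_map (rep_val S a) = rep_val S' a.
Proof. by apply: sp_mapE; apply: theta_val. Qed.

Lemma sp_map_up g a : tgt g = src a ->
  la (up_act S') (sp_map g) a = la (up_act S) g a.
Proof.
move=> h; have h' : tgt (sp_map g) = src a by rewrite sp_map_tgt.
have [[_ _ H] _] := sp_map_theta g; have := H (inl a) h.
by rewrite !upD_inl // => -[].
Qed.

Lemma sp_map_dn g a : tgt g = src a ->
  la (dn_act S') (sp_map g) a = la (dn_act S) g a.
Proof.
move=> h; have h' : tgt (sp_map g) = src a by rewrite sp_map_tgt.
have [_ [_ _ H]] := sp_map_theta g; have := H (inl a) h.
by rewrite !dnD_inl // => -[].
Qed.

Lemma sp_map_R_of_L g h : tgt g = src h ->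
  sp_map (la (up_l G) g h) = la (up_l G') (sp_map g) (sp_map h) ->
  sp_map (ra (up_r G) g h) = ra (up_r G') (sp_map g) (sp_map h).
Proof.
move=> e H; have e' : tgt (sp_map g) = src (sp_map h).
  by rewrite sp_map_src sp_map_tgt.
rewrite !R_LE // sp_map_cmp ?ginv_tgt ?src_cmp ?L_src //.
by rewrite sp_map_inv H sp_map_cmp.
Qed.

(** On a generator [|a|] the left action is the value of [up g a], and [up] is preserved by
    construction. The rest is induction on a word for [h], for all [g] at once because [g] changes
    along the word. *)
Lemma sp_map_L g h : tgt g = src h ->
  sp_map (la (up_l G) g h) = la (up_l G') (sp_map g) (sp_map h).
Proof.
have ends f k : tgt f = src k -> tgt (sp_map f) = src (sp_map k).
  by rewrite sp_map_src sp_map_tgt.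
elim: (sp_gen h) g => [_ [a ->]|q|k _ IH|k l kl _ IHk _ IHl] g e.
- rewrite sp_map_val -!rep_val_la ?sp_map_tgt ?e ?qfun_src // sp_map_val.
  by rewrite sp_map_up // e qfun_src.
- rewrite sp_map_id !L_id ?sp_map_tgt ?e ?gid_src //.
  by rewrite sp_map_id sp_map_src.
(* The square on [g] and [ginv k] is the reflection of the square on [R g (ginv k)] and [k], to
   which the induction hypothesis applies. *)
- have [E1 E2] := LR_inv e; rewrite ginvK in E1 E2.
  have e0 : tgt (ra (up_r G) g (ginv k)) = src k by rewrite R_tgt // ginv_tgt.
  have ER := sp_map_R_of_L e0 (IH _ e0).
  have EL := IH _ e0.
  rewrite E2 in ER; rewrite E1 in EL.
  have [E3 _] := LR_inv (ends _ _ e0).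
  rewrite sp_map_inv ER E3 -EL -sp_map_inv.
  by rewrite ginvK.
rewrite cmpE in e *; rewrite src_cmp in e.
have e1 : tgt (ra (up_r G) g k) = src l by rewrite R_tgt.
have h1 := ends _ _ e; have h2 := ends _ _ kl.
rewrite sp_map_cmp // (L_cmp h1 h2) (L_cmp e kl).
rewrite sp_map_cmp; last by rewrite L_tgt // L_src.
by rewrite IHk // IHl // sp_map_R_of_L // IHk.
Qed.

Lemma sp_map_R g h : tgt g = src h ->
  sp_map (ra (up_r G) g h) = ra (up_r G') (sp_map g) (sp_map h).
Proof. by move=> e; apply: sp_map_R_of_L => //; apply: sp_map_L. Qed.

Lemma sp_isomorphic_of_same_box : sp_isomorphic S S'.
Proof.
exists (QMor sp_map_src sp_map_tgt); split.
- exact: sp_map_bij.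
- by move=> f g h h'; rewrite !cmpE /= sp_map_cmp.
- by split=> f g h h'; rewrite ?laE ?raE /= ?sp_map_L ?sp_map_R.
- exact: sp_map_val.
move=> X a h h'; rewrite !rep_act_pair.
case: X h h' => -[f g] hX /= h h'.
have e1 : tgt g = src a := h; have e2 : tgt f = src g := hX.
by rewrite sp_map_up // sp_map_dn // la_base.
Qed.
End SameBraidingIso.

(** Preserving products, [psi] preserves identities (as idempotents) and inverses. It thus carries
    the elements [(id, g)] and [(g, id)] to elements of the same form, hence respects [up] and [dn],
    from which boxes are computed. *)
Lemma same_box_of_sp_isomorphic (P : Type) (A : quiver P) (S S' : structural_pair A) :
  sp_isomorphic S S' -> forall x y u v, rep_box S x y u v -> rep_box S' x y u v.
Proof.
case=> psi [_ psiM _ psi_val psi_act].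
have psi1 q : psi (gid _ q) = gid _ q.
  have h : tgt (gid (sp_groupoid S) q) = src (gid (sp_groupoid S) q).
    by rewrite gid_src gid_tgt.
  have h' : tgt (psi (gid (sp_groupoid S) q)) = src (psi (gid (sp_groupoid S) q)).
    by rewrite qfun_src qfun_tgt.
  have := psiM _ _ h h'; rewrite gcomp1l => /esym E; rewrite (idem_id E).
  by rewrite qfun_tgt gid_tgt.
have psiV g : psi (ginv g) = ginv (psi g).
  have h : tgt g = src (ginv g) by rewrite ginv_src.
  have h' : tgt (psi g) = src (psi (ginv g)) by rewrite qfun_src qfun_tgt.
  have := psiM _ _ h h'; rewrite gcompV psi1 => /esym E.
  exact: ginv_uniq E.
have psi_up g a : tgt g = src a ->
    la (up_act S') (psi g) a = la (up_act S) g a.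
  move=> h; have h' : tgt (psi g) = src a by rewrite qfun_tgt.
  have := psi_act (emb_up g) a h h'; rewrite !rep_act_pair /= psi1.
  by rewrite !la1 // la_base // qfun_src.
have psi_dn g a : tgt g = src a ->
    la (dn_act S') (psi g) a = la (dn_act S) g a.
  move=> h; have h' : tgt (psi g) = src a by rewrite qfun_tgt.
  have h1 : tgt (emb_dn g) = src a by rewrite emb_dn_tgt.
  have h2 : tgt (qprod_map psi psi (emb_dn g)) = src a by rewrite qfun_tgt.
  have := psi_act (emb_dn g) a h1 h2; rewrite !rep_act_pair /= psi1.
  by rewrite !la1.
move=> x y u v B; have [h eu ev] := B; split=> //.
  by rewrite -psi_val psi_up // qfun_tgt.
rewrite -psi_val -psiV psi_dn // ginv_tgt qfun_src.
exact: rep_box_src B.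
Qed.

(** * The structural pair of a braiding *)

Section BoxCorners.
Variables (P : Type) (A : quiver P) (b : nd_braiding A).
Notation B := (box b).
Implicit Types x y z u v w : A.

(** Any corner determines the box: [u, v] by invertibility of the braiding, [x, u] and [y, v] below
    by the two halves of non-degeneracy. *)
Lemma box_corner_uv u v : tgt u = src v -> exists x y, B x y u v.
Proof.
move=> h; have [f _ fK] := braiding_bij b.
have e := fK (qpair h); case: (f _) e => -[x y] hp e.
exists x, y, hp; rewrite /qleft /qright.
have -> : qpair (hp : tgt x = src y) = exist _ (x, y) hp by [].
by rewrite e.
Qed.

Lemma box_fun_uv x y x' y' u v : B x y u v -> B x' y' u v -> x = x' /\ y = y'.
Proof.
move=> [h [e1 e2]] [h' [e1' e2']].
have e : b (qpair h) = b (qpair h').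
  apply: sval_inj; move: e1 e2 e1' e2'; rewrite /qleft /qright.
  by case: (sval _) (sval _) => [? ?] [? ?] /= -> -> -> ->.
have E := bij_inj (braiding_bij b) e; have := congr1 sval E.
by case.
Qed.

Lemma box_corner_xu x u : src u = src x -> exists y v, B x y u v.
Proof.
move=> h; have [[f _ fK] _] := braiding_nd b x.
have := fK (mkfiber h); case: (f _) => y hy /(congr1 sval) /= <-.
by exists y; eexists; apply: box_sigma.
Qed.

Lemma box_fun_xu x y y' u v v' : B x y u v -> B x y' u v' -> y = y' /\ v = v'.
Proof.
move=> B1 B2; suff e : y = y' by subst y'; have [_ ->] := box_fun B1 B2.
have [/bij_inj fi _] := braiding_nd b x.
case: B1 B2 => h [e1 _] [h' [e1' _]].
suff E : mkfiber (esym h) = mkfiber (esym h') by have := congr1 sval E.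
apply: fi; apply: sval_inj => /=.
by rewrite (Prop_irrelevance (esym _) h) (Prop_irrelevance (esym _) h') e1 e1'.
Qed.

Lemma box_corner_yv y v : tgt v = tgt y -> exists x u, B x y u v.
Proof.
move=> h; have [_ [f _ fK]] := braiding_nd b y.
have := fK (mkfiber h); case: (f _) => x hx /(congr1 sval) /= <-.
by exists x; eexists; apply: box_sigma.
Qed.

Lemma box_fun_yv x x' y u u' v : B x y u v -> B x' y u' v -> x = x' /\ u = u'.
Proof.
move=> B1 B2; suff e : x = x' by subst x'; have [-> _] := box_fun B1 B2.
have [_ /bij_inj fi] := braiding_nd b y.
case: B1 B2 => h [_ e1] [h' [_ e1']].
suff E : mkfiber h = mkfiber h' by have := congr1 sval E.
apply: fi; apply: sval_inj => /=.
apply: etrans (etrans _ e1) (etrans (esym e1') _); congr qright;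
  exact: Prop_irrelevance.
Qed.

(** The braid equation as a cube: here and in the converse below, three boxes forming one half are
    traded for the other half, with the outer edges kept. *)
Lemma ybe_left_right x y z u v w z' x1 w' :
  B x y u v -> B v z w z' -> B u w x1 w' ->
  exists y1 z1 x2, [/\ B y z y1 z1, B x y1 x1 x2 & B x2 z1 w' z'].
Proof.
move=> b1 b2 b3.
have [hxy _ _ hv] := box_ends b1; have [hvz _ _ _] := box_ends b2.
have [y1 [z1 b4]] : exists y1 z1, B y z y1 z1 by apply: box_total; rewrite -hv.
have [_ hy1 hyz1 _] := box_ends b4.
have [x1' [x2 b5]] : exists x1 x2, B x y1 x1 x2 by apply: box_total; rewrite hy1.
have [_ _ _ hx2] := box_ends b5.
have [w'' [z'' b6]] : exists w z, B x2 z1 w z by apply: box_total; rewrite hx2.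
have /braid_equationP E := braiding_braid b.
have [ex ew ez] := E _ _ _ _ _ _ _ _ _ _ _ _ _ _ _ b1 b2 b3 b4 b5 b6.
by exists y1, z1, x2; rewrite ex ew ez.
Qed.

Lemma ybe_right_left x y z y1 z1 x1 x2 w' z' :
  B y z y1 z1 -> B x y1 x1 x2 -> B x2 z1 w' z' ->
  exists u v w, [/\ B x y u v, B v z w z' & B u w x1 w'].
Proof.
move=> b4 b5 b6.
have [hyz hy1 hyz1 _] := box_ends b4; have [hxy _ _ _] := box_ends b5.
have [u [v b1]] : exists u v, B x y u v by apply: box_total; rewrite hxy.
have [_ _ huv hv] := box_ends b1.
have [w [z'' b2]] : exists w z', B v z w z' by apply: box_total; rewrite hv.
have [_ hw _ _] := box_ends b2.
have [x1' [w'' b3]] : exists x1 w', B u w x1 w' by apply: box_total; rewrite hw.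
have /braid_equationP E := braiding_braid b.
have [ex ew ez] := E _ _ _ _ _ _ _ _ _ _ _ _ _ _ _ b1 b2 b3 b4 b5 b6.
by exists u, v, w; rewrite -ex -ew -ez.
Qed.
End BoxCorners.

(** * Partial bijections, letters, strips and grids *)

Section Relations.
Variables (P : Type) (A : quiver P).

(* Lp, Ln: the action |> on the arrows of A and on their formal inverses; Tp, Tn:
   likewise for the action of the inverse braiding. *)
Inductive mode := Lp | Ln | Tp | Tn.

Definition endm (m : mode) (a : A) : P :=
  match m with Lp | Tp => src a | Ln | Tn => tgt a end.

(* Partial bijections are encoded as relations, so that composition is total and
   associative; composites of non-composable elements are junk, outside inG below. *)
Record raw := Raw { rsrc : P; rtgt : P; rrel : mode -> A -> A -> Prop }.
Implicit Types (f g h k : raw) (m : mode).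

Lemma raw_eq f g : rsrc f = rsrc g -> rtgt f = rtgt g ->
  (forall m a c, rrel f m a c <-> rrel g m a c) -> f = g.
Proof.
case: f g => [p q R] [p' q' R'] /= -> -> H; congr Raw.
by apply/funext => m; apply/funext => a; apply/funext => c; apply/propext.
Qed.

Definition rmul f g : raw :=
  Raw (rsrc f) (rtgt g) (fun m a c => exists2 d, rrel g m a d & rrel f m d c).
Definition rone (p : P) : raw := Raw p p (fun m a c => a = c /\ endm m a = p).
Definition rinv f : raw := Raw (rtgt f) (rsrc f) (fun m a c => rrel f m c a).

Lemma rmulA f g k : rmul f (rmul g k) = rmul (rmul f g) k.
Proof.
apply: raw_eq => // m a c; split.
  by case=> d [e ? ?] ?; exists e => //; exists d.
by case=> d ? [e ? ?]; exists e => //; exists d.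
Qed.

Lemma rinvK f : rinv (rinv f) = f. Proof. exact: raw_eq. Qed.

(** Relational form of four arrows of groupoids [aut], one for each mode, with common ends. *)
Definition good f : Prop := forall m,
  [/\ forall a c, rrel f m a c -> endm m a = rtgt f /\ endm m c = rsrc f,
      forall a, endm m a = rtgt f -> exists c, rrel f m a c,
      forall c, endm m c = rsrc f -> exists a, rrel f m a c,
      forall a c c', rrel f m a c -> rrel f m a c' -> c = c'
    & forall a a' c, rrel f m a c -> rrel f m a' c -> a = a'].

Lemma good_one p : good (rone p).
Proof.
move=> m; split => /=.
- by move=> a c [<- ->].
- by move=> a h; exists a.
- by move=> a h; exists a.
- by move=> a c c' [<- _] [<- _].
- by move=> a c c' [-> _] [-> _].
Qed.

Lemma good_inv f : good f -> good (rinv f).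
Proof.
move=> H m; have [H1 H2 H3 H4 H5] := H m; split => //=.
- by move=> a c /H1 [].
- by move=> a c c'; apply: H5.
- by move=> a c c'; apply: H4.
Qed.

Lemma good_mul f g : rtgt f = rsrc g -> good f -> good g -> good (rmul f g).
Proof.
move=> e Hf Hg m; have [f1 f2 f3 f4 f5] := Hf m; have [g1 g2 g3 g4 g5] := Hg m.
split=> /=.
- by move=> a c [d /g1[? ?] /f1[]].
- move=> a /g2 [d ad]; have [c dc] : exists c, rrel f m d c.
    by apply: f2; rewrite e; have [] := g1 _ _ ad.
  by exists c, d.
- move=> c /f3 [d dc]; have [a ad] : exists a, rrel g m a d.
    by apply: g3; rewrite -e; have [] := f1 _ _ dc.
  by exists a, d.
- by move=> a c c' [d /g4 E dc] [d' /E <- /(f4 _ _ _ dc)].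
- by move=> a a' c [d ad /f5 E] [d' ad' /E e']; apply: g5 ad _; rewrite e'.
Qed.

Lemma rmul1r f p : good f -> rtgt f = p -> rmul f (rone p) = f.
Proof.
move=> H e; apply: raw_eq => // m a c; have [H1 _ _ _ _] := H m.
split=> [[d [<- _]] //|ac]; exists a => //; split=> //.
by have [-> _] := H1 _ _ ac.
Qed.

Lemma rmul1l f p : good f -> rsrc f = p -> rmul (rone p) f = f.
Proof.
move=> H e; apply: raw_eq => // m a c; have [H1 _ _ _ _] := H m.
split=> [[d ad [<- _]] //|ac]; exists c => //; split=> //.
by have [_ ->] := H1 _ _ ac.
Qed.

Lemma rmulV f : good f -> rmul f (rinv f) = rone (rsrc f).
Proof.
move=> H; apply: raw_eq => // m a c; have [H1 H2 H3 H4 H5] := H m.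
split=> [[d da dc]|[<- h]].
  by split; [apply: H4 da dc|have [] := H1 _ _ da].
by have [d da] := H3 _ h; exists d.
Qed.

Lemma rmulVl f : good f -> rmul (rinv f) f = rone (rtgt f).
Proof. by move=> /good_inv/rmulV; rewrite rinvK. Qed.

Lemma rmulI f g k : good f -> good g -> good k -> rsrc g = rtgt f -> rsrc k = rtgt f ->
  rmul f g = rmul f k -> g = k.
Proof.
move=> Hf Hg Hk eg ek /(congr1 (rmul (rinv f))).
by rewrite !rmulA rmulVl // !rmul1l.
Qed.

Lemma rmulIr f g k : good f -> good g -> good k -> rtgt g = rsrc f -> rtgt k = rsrc f ->
  rmul g f = rmul k f -> g = k.
Proof.
move=> Hf Hg Hk eg ek /(congr1 (fun e => rmul e (rinv f))).
by rewrite -!rmulA rmulV // !rmul1r.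
Qed.

(** For graphs of bijections between the same fibres one inclusion is enough, which halves the
    verification of relations between letters. *)
Lemma raw_sub f g : good f -> good g -> rsrc f = rsrc g -> rtgt f = rtgt g ->
  (forall m a c, rrel f m a c -> rrel g m a c) -> f = g.
Proof.
move=> Hf Hg es et H; apply: raw_eq => // m a c; split; first exact: H.
move=> ac; have [g1 _ _ g4 _] := Hg m; have [_ f2 _ _ _] := Hf m.
have [|d ad] := f2 a; first by rewrite et; have [] := g1 _ _ ac.
by rewrite (g4 _ _ _ ac (H _ _ _ ad)).
Qed.

Variable b : nd_braiding A.
Notation B := (box b).
Implicit Types x y u v : A.

(** The clauses are the four formulas that [|x|] obeys in a representation, as in [rep_box_upD_inl],
    with boxes now taken from the given braiding. The map [letter] need not be injective. *)
Definition letter x : raw := Raw (src x) (tgt x) (fun m a c =>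
  match m with
  | Lp => exists v, B x a c v
  | Ln => exists x', B x' a c x
  | Tp => exists y, B c y x a
  | Tn => exists u, B c x u a
  end).

(** Existence and uniqueness of images and preimages say that a corner completes to a unique box;
    over the four modes each kind of corner occurs twice. *)
Lemma good_letter x : good (letter x).
Proof.
case; split=> /=.
- by move=> a c [v /box_ends[]].
- by move=> a h; have [|u [v H]] := @box_total _ _ b x a; [|exists u, v].
- by move=> c /(box_corner_xu b) [y [v H]]; exists y, v.
- by move=> a c c' [v H] [v' /(box_fun H)[]].
- by move=> a c c' [v H] [v' /(box_fun_xu H)[]].
- by move=> a c [v /box_ends[? ? ? ?]].
- by move=> a h; have [|y [u H]] := @box_corner_yv _ _ b a x; [|exists u, y].
- by move=> c h; have [|y [u H]] := @box_corner_uv _ _ b c x; [|exists u, y].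
- by move=> a c c' [v H] [v' /(box_fun_yv H)[]].
- by move=> a c c' [v H] [v' /(box_fun_uv H)[]].
- by move=> a c [v /box_ends[]].
- by move=> a h; have [|y [u H]] := @box_corner_uv _ _ b x a; [|exists y, u].
- by move=> c h; have [|y [u H]] := @box_corner_xu _ _ b c x; [|exists u, y].
- by move=> a c c' [v H] [v' /(box_fun_uv H)[]].
- by move=> a c c' [v H] [v' /(box_fun_xu H)[]].
- by move=> a c [v /box_ends[]].
- by move=> a h; have [|y [u H]] := @box_corner_yv _ _ b x a; [|exists y, u].
- by move=> c h; have [|y [u H]] := @box_total _ _ b c x; [|exists u, y].
- by move=> a c c' [v H] [v' /(box_fun_yv H)[]].
- by move=> a c c' [v H] [v' /(box_fun H)[]].
Qed.

(** The groupoid generated by the letters. The condition on ends in [inG_mul] excludes junk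
    composites, so that all members are [good]. *)
Inductive inG : raw -> Prop :=
| inG_letter x : inG (letter x)
| inG_one p : inG (rone p)
| inG_inv f : inG f -> inG (rinv f)
| inG_mul f g : rtgt f = rsrc g -> inG f -> inG g -> inG (rmul f g).

Lemma inG_good f : inG f -> good f.
Proof.
elim=> [x|p|k _|k l e _ ? _ ?]; first exact: good_letter.
- exact: good_one.
- exact: good_inv.
- exact: good_mul.
Qed.
Hint Resolve inG_good good_letter good_one inG_letter inG_one : core.

(** In every mode, the two boxes of a composite of letters extend to one half of a cube having the
    given box as a face; the other half supplies the boxes of the other composite. *)
Lemma letter_box x y u v : B x y u v ->
  rmul (letter x) (letter y) = rmul (letter u) (letter v).
Proof.
move=> H; have [hxy hu huv hv] := box_ends H.
apply: raw_sub; [exact: good_mul|exact: good_mul|by []|by []|].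
case=> a c [d].
- move=> [z1 H1] [x2 H2].
  have [_ _ _ h] := box_ends H2; have [_ _ h1 _] := box_ends H1.
  have [w' [z' H3]] := @box_total _ _ b x2 z1 (etrans h h1).
  have [u' [v' [w [G1 G2 G3]]]] := ybe_right_left H1 H2 H3.
  have [eu ev] := box_fun H G1; subst u' v'.
  by exists w; [exists z'|exists w'].
- move=> [x0 H1] [x1 H2].
  have [u' [v' [w [G1 G2 G3]]]] := ybe_right_left H1 H2 H.
  by exists w; [exists v'|exists u'].
- move=> [k H1] [k' H2].
  have [y1 [z1 [x2 [G1 G2 G3]]]] := ybe_left_right H2 H1 H.
  by exists x2; [exists z1|exists y1].
move=> [u0 H1] [u1 H2].
have [h _ h1 _] := box_ends H2; have [_ h2 _ _] := box_ends H1.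
have h3 : tgt u1 = src u0 by rewrite h1 h2.
have [x1 [w' H3]] := box_total b h3.
have [y1 [z1 [x2 [G1 G2 G3]]]] := ybe_left_right H2 H1 H3.
have [eu ev] := box_fun H G1; subst y1 z1.
by exists x2; [exists w'|exists x1].
Qed.

(* A row of boxes and inverses of boxes, with left side x, bottom h, top h' and right
   side x'. *)
Record strip x h h' x' : Prop := Strip {
  strip_in : inG h;
  strip_in' : inG h';
  strip_comm : rmul (letter x) h = rmul h' (letter x');
  strip_Tn : rrel h Tn x' x;
  strip_Tp : rrel h' Tp x' x }.

Lemma strip_ends x h h' x' : strip x h h' x' ->
  [/\ tgt x = rsrc h, rtgt h' = src x', src x = rsrc h' & tgt x' = rtgt h].
Proof.
case=> H H' _ Hn Hp.
have [/(_ _ _ Hn)[/= ? ?] _ _ _ _] := inG_good H Tn.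
by have [/(_ _ _ Hp)[/= ? ?] _ _ _ _] := inG_good H' Tp.
Qed.

Lemma strip_letter x y u v : B x y u v -> strip x (letter y) (letter u) v.
Proof. by move=> H; split=> //; [apply: letter_box|exists u|exists y]. Qed.

Lemma strip_one x : strip x (rone (tgt x)) (rone (src x)) x.
Proof. by split=> //; rewrite rmul1l ?rmul1r. Qed.

Lemma strip_mul x h h' x1 k k' x2 :
  strip x h h' x1 -> strip x1 k k' x2 -> strip x (rmul h k) (rmul h' k') x2.
Proof.
move=> S1 S2; have [e1 e2 e3 e4] := strip_ends S1.
have [f1 f2 f3 f4] := strip_ends S2; case: S1 S2 => [H1 H1' c1 n1 p1] [H2 H2' c2 n2 p2].
split.
- by apply: inG_mul => //; rewrite -e4.
- by apply: inG_mul => //; rewrite e2.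
- by rewrite rmulA c1 -rmulA c2 rmulA.
- by exists x1.
- by exists x1.
Qed.

Lemma strip_inv x h h' x' : strip x h h' x' -> strip x' (rinv h) (rinv h') x.
Proof.
move=> S; have [e1 e2 e3 e4] := strip_ends S; case: S => H H' c n p.
have H0 := inG_good H; have H0' := inG_good H'.
split=> //; try exact: inG_inv.
have g1 := good_inv H0; have g2 := good_inv H0'.
apply: (rmulI H0') => //; try exact: good_mul.
rewrite !rmulA -c rmulV // rmul1l // -rmulA rmulV //.
by rewrite rmul1r.
Qed.

(** [strip_comm] forces the top to be [x h x'^-1], so it depends on the element [h] and not on the
    word along which the strip was assembled. *)
Lemma strip_fun x h h1 h2 x' : strip x h h1 x' -> strip x h h2 x' -> h1 = h2.
Proof.
move=> S1 S2; have [_ e1 _ _] := strip_ends S1; have [_ e2 _ _] := strip_ends S2.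
case: S1 S2 => _ H1 c1 _ _ [_ H2 c2 _ _].
by apply: (rmulIr (good_letter x')); rewrite -?c1; auto.
Qed.

Lemma strip_inj x h1 h2 h' x' : strip x h1 h' x' -> strip x h2 h' x' -> h1 = h2.
Proof.
move=> S1 S2; have [e1 _ _ _] := strip_ends S1; have [e2 _ _ _] := strip_ends S2.
case: S1 S2 => H1 _ c1 _ _ [H2 _ c2 _ _].
by apply: (rmulI (good_letter x)); rewrite ?c1 ?c2; auto.
Qed.

(** The right end [x'] is the arrow that [h] carries to [x] in mode [Tn]; the strip is then
    assembled along a word for [h]. The dual version below starts from the top, in mode [Tp]. *)
Lemma strip_exists h : inG h -> forall x x', rrel h Tn x' x -> exists h', strip x h h' x'.
Proof.
elim=> [y|p|k _ IH|k l e _ IHk _ IHl] x x' /=.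
- by case=> u H; exists (letter u); apply: strip_letter.
- by case=> -> <-; eexists; apply: strip_one.
- by move/IH => [k' S]; exists (rinv k'); apply: strip_inv.
case=> x1 /IHl [l' Sl] /IHk [k' Sk].
by exists (rmul k' l'); apply: strip_mul Sk Sl.
Qed.

Lemma strip_exists' h' : inG h' ->
  forall x x', rrel h' Tp x' x -> exists h, strip x h h' x'.
Proof.
elim=> [y|p|k _ IH|k l e _ IHk _ IHl] x x' /=.
- by case=> u H; exists (letter u); apply: strip_letter.
- by case=> -> <-; eexists; apply: strip_one.
- by move/IH => [k' S]; exists (rinv k'); apply: strip_inv.
case=> x1 /IHl [l' Sl] /IHk [k' Sk].
by exists (rmul k' l'); apply: strip_mul Sk Sl.
Qed.

(* grid g h h' g': left side g, bottom h, top h', right side g'. *)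
Inductive grid : raw -> raw -> raw -> raw -> Prop :=
| grid_strip x h h' x' : strip x h h' x' -> grid (letter x) h h' (letter x')
| grid_one h : inG h -> grid (rone (rsrc h)) h h (rone (rtgt h))
| grid_mul g1 g2 h h1 h2 g1' g2' :
    grid g1 h1 h2 g1' -> grid g2 h h1 g2' -> grid (rmul g1 g2) h h2 (rmul g1' g2')
| grid_inv g h h' g' : grid g h h' g' -> grid (rinv g) h' h (rinv g').

Lemma grid_ends g h h' g' : grid g h h' g' ->
  [/\ rtgt g = rsrc h, rtgt h' = rsrc g', rsrc g = rsrc h' & rtgt g' = rtgt h].
Proof.
elim=> {g h h' g'} [x h h' x' /strip_ends[]//|h _ //| |].
- by move=> g1 g2 h h1 h2 g1' g2' _ [? ? ? ?] _ [? ? ? ?]; split.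
by move=> g h h' g' _ [? ? ? ?]; split.
Qed.

Lemma grid_in g h h' g' : grid g h h' g' -> [/\ inG g, inG h, inG h' & inG g'].
Proof.
elim=> {g h h' g'} [x h h' x' []//|h //| |].
- move=> g1 g2 h h1 h2 g1' g2' /grid_ends[? ? ? ?] [? ? ? ?].
  move=> /grid_ends[? ? ? ?] [? ? ? ?]; split=> //; apply: inG_mul => //; congruence.
by move=> g h h' g' _ [? ? ? ?]; split=> //; apply: inG_inv.
Qed.

Lemma grid_LT g h h' g' : grid g h h' g' -> rmul g h = rmul h' g'.
Proof.
elim=> {g h h' g'} [x h h' x' []//|h H| |].
- by rewrite rmul1l ?rmul1r; auto.
- move=> g1 g2 h h1 h2 g1' g2' _ e1 _ e2.
  by rewrite -rmulA e2 rmulA e1 rmulA.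
move=> g h h' g' H e; have [e1 e2 e3 e4] := grid_ends H.
have [/inG_good g1 /inG_good g2 /inG_good g3 /inG_good g4] := grid_in H.
have g1' := good_inv g1; have g4' := good_inv g4.
apply: (rmulI g1) => //=; try by apply: good_mul => //=; congruence.
rewrite !rmulA rmulV // e -rmulA rmulV // rmul1l // rmul1r //.
Qed.

(** Existence over a given bottom and under a given top are proved together, since inverting the
    left side exchanges bottom and top. *)
Lemma grid_total g : inG g ->
  (forall h, inG h -> rtgt g = rsrc h -> exists h' g', grid g h h' g') /\
  (forall h', inG h' -> rsrc g = rsrc h' -> exists h g', grid g h h' g').
Proof.
elim=> {g} [x|p|k _ [IH1 IH2]|k l e _ [IHk1 IHk2] _ [IHl1 IHl2]].
- split=> h H /= e.
    have [_ _ H3 _ _] := inG_good H Tn; have [x' Hx] := H3 x e.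
    have [h' S] := strip_exists H Hx.
    by exists h', (letter x'); apply: grid_strip.
  have [_ _ H3 _ _] := inG_good H Tp; have [x' Hx] := H3 x e.
  have [h' S] := strip_exists' H Hx.
  by exists h', (letter x'); apply: grid_strip.
- by split=> h H /= ->; exists h, (rone (rtgt h)); apply: grid_one.
- split=> h H /= e'.
    by have [h' [g' S]] := IH2 h H e'; exists h', (rinv g'); apply: grid_inv.
  by have [h' [g' S]] := IH1 h H e'; exists h', (rinv g'); apply: grid_inv.
split=> h H /= e'.
  have [h1 [l' S]] := IHl1 h H e'; have [_ _ H1 _] := grid_in S.
  have [_ _ e1 _] := grid_ends S.
  have [h2 [k' S']] := IHk1 h1 H1 (etrans e e1).
  by exists h2, (rmul k' l'); apply: grid_mul S' S.
have [h1 [k' S]] := IHk2 h H e'; have [_ H1 _ _] := grid_in S.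
have [e1 _ _ _] := grid_ends S.
have [h2 [l' S']] := IHl2 h1 H1 (etrans (esym e) e1).
by exists h2, (rmul k' l'); apply: grid_mul S S'.
Qed.

(** Over a single letter a grid is a column of boxes, so its top can be computed from either
    vertical side. As [letter] may identify arrows, the claim is made for every [y] representing the
    bottom. *)
Lemma grid_letter g h h' g' : grid g h h' g' ->
  (forall y, h = letter y ->
     exists u, [/\ h' = letter u, rrel g Lp y u & rrel g' Ln y u]) /\
  (forall u, h' = letter u ->
     exists y, [/\ h = letter y, rrel g Lp y u & rrel g' Ln y u]).
Proof.
elim=> {g h h' g'} [x h h' x' S|h H| |].
- split=> y e; subst.
    have [u H] := strip_Tn S; exists u; split; [|by exists x'|by exists x].
    exact: strip_fun S (strip_letter H).
  have [u H] := strip_Tp S; exists u; split; [|by exists x'|by exists x].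
  exact: strip_inj S (strip_letter H).
- by split=> y e; exists y; subst.
- move=> g1 g2 h h1 h2 g1' g2' _ [IH1 IH2] _ [IH3 IH4]; split=> y.
    move=> /IH3 [u [/IH1 [w [e r1 r2]] r3 r4]].
    by exists w; split=> //; exists u.
  move=> /IH2 [u [/IH4 [w [e r1 r2]] r3 r4]].
  by exists w; split=> //; exists u.
move=> g h h' g' _ [IH1 IH2]; split=> y.
  by move=> /IH2 [u [? ? ?]]; exists u.
by move=> /IH1 [u [? ? ?]]; exists u.
Qed.

(** A grid can be cut along any factorisation of its bottom, whatever its construction: in a strip,
    the letter at the cut is read off from the action of [c], and [strip_fun] shows that the two
    pieces have the right total top. *)
Lemma grid_split g h h' g' : grid g h h' g' ->
  (forall a c : raw, inG a -> inG c -> rtgt a = rsrc c -> h = rmul a c ->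
     exists a' c' g1, [/\ grid g a a' g1, grid g1 c c' g' & h' = rmul a' c']) /\
  (forall a' c' : raw, inG a' -> inG c' -> rtgt a' = rsrc c' -> h' = rmul a' c' ->
     exists a c g1, [/\ grid g a a' g1, grid g1 c c' g' & h = rmul a c]).
Proof.
elim=> {g h h' g'} [x h h' x' S|h H| |].
- split=> a c Ha Hc e eh; subst.
    have [x1 /(strip_exists Hc)[c' Sc] /(strip_exists Ha)[a' Sa]] := strip_Tn S.
    exists a', c', (letter x1); split; try exact: grid_strip.
    exact: strip_fun S (strip_mul Sa Sc).
  have [x1 /(strip_exists' Hc)[c' Sc] /(strip_exists' Ha)[a' Sa]] := strip_Tp S.
  exists a', c', (letter x1); split; try exact: grid_strip.
  exact: strip_inj S (strip_mul Sa Sc).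
- split=> a c Ha Hc e eh; subst; exists a, c, (rone (rtgt a)).
    by split=> //; [exact: (grid_one Ha)|rewrite e; exact: (grid_one Hc)].
  by split=> //; [exact: (grid_one Ha)|rewrite e; exact: (grid_one Hc)].
- move=> g1 g2 h h1 h2 g1' g2' _ [IH1 IH2] _ [IH3 IH4]; split=> a c Ha Hc e eh.
    have [a1 [c1 [k [s1 s2 e1]]]] := IH3 a c Ha Hc e eh.
    have [_ _ Ha1 _] := grid_in s1; have [_ _ Hc1 _] := grid_in s2.
    have [_ e2 _ _] := grid_ends s1; have [_ _ e3 _] := grid_ends s2.
    have [a2 [c2 [l [t1 t2 e4]]]] := IH1 a1 c1 Ha1 Hc1 (etrans e2 e3) e1.
    exists a2, c2, (rmul l k); split=> //; first exact: grid_mul t1 s1.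
    exact: grid_mul t2 s2.
  have [a1 [c1 [k [s1 s2 e1]]]] := IH2 a c Ha Hc e eh.
  have [_ Ha1 _ _] := grid_in s1; have [_ Hc1 _ _] := grid_in s2.
  have [_ _ _ e2] := grid_ends s1; have [e3 _ _ _] := grid_ends s2.
  have [a2 [c2 [l [t1 t2 e4]]]] := IH4 a1 c1 Ha1 Hc1 (etrans (esym e2) e3) e1.
  by exists a2, c2, (rmul k l); split=> //; [apply: grid_mul s1 t1|apply: grid_mul s2 t2].
move=> g h h' g' _ [IH1 IH2]; split=> a c Ha Hc e eh.
  have [a1 [c1 [k [s1 s2 e1]]]] := IH2 a c Ha Hc e eh.
  by exists a1, c1, (rinv k); split=> //; apply: grid_inv.
have [a1 [c1 [k [s1 s2 e1]]]] := IH1 a c Ha Hc e eh.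
by exists a1, c1, (rinv k); split=> //; apply: grid_inv.
Qed.

Lemma grid_id g h h' g' : grid g h h' g' ->
  (h = rone (rtgt g) -> h' = rone (rsrc g)) /\ (h' = rone (rsrc g) -> h = rone (rtgt g)).
Proof.
elim=> {g h h' g'} [x h h' x' S|h H| |] /=.
- split=> e; subst.
    have [/= e _] := strip_Tn S; subst x'; exact: strip_fun S (strip_one x).
  have [/= e _] := strip_Tp S; subst x'; exact: strip_inj S (strip_one x).
- by split=> e; rewrite e.
- move=> g1 g2 h h1 h2 g1' g2' s1 [IH1 IH2] s2 [IH3 IH4].
  have [e1 _ _ _] := grid_ends s1; have [_ _ e2 _] := grid_ends s2.
  have e : rtgt g1 = rsrc g2 by congruence.
  split=> eh; first by apply: IH1; rewrite e; exact: IH3.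
  by apply: IH4; rewrite -e; exact: IH2.
by move=> g h h' g' _ [].
Qed.

Lemma grid_flip g h h' g' : grid g h h' g' -> grid g' (rinv h) (rinv h') g.
Proof.
elim=> {g h h' g'} [x h h' x' /strip_inv S|h H| |].
- exact: grid_strip.
- by have := grid_one (inG_inv H).
- by move=> g1 g2 h h1 h2 g1' g2' _ ? _ ?; apply: grid_mul; eauto.
by move=> g h h' g' _ ?; apply: grid_inv.
Qed.

(** By [grid_LT] the right side is [h'^-1 g h]. *)
Lemma grid_cancel g g1 g2 h h' : grid g h h' g1 -> grid g h h' g2 -> g1 = g2.
Proof.
move=> s1 s2; have [_ _ /inG_good G3 /inG_good G4] := grid_in s1.
have [_ _ _ /inG_good G4'] := grid_in s2.
have [_ e1 _ _] := grid_ends s1; have [_ e2 _ _] := grid_ends s2.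
by apply: (rmulI G3) => //; rewrite -(grid_LT s1) -(grid_LT s2).
Qed.

Lemma grid_cancel' g g1 g2 h h' : grid g1 h h' g -> grid g2 h h' g -> g1 = g2.
Proof.
by move=> /grid_flip s1 /grid_flip s2; apply: grid_cancel s1 s2.
Qed.

(** Induction on a word for the bottom. Letters are settled by [grid_letter]; for a product both
    grids are cut at the same place, and cancellation identifies the two cuts. For an inverse,
    reflection exchanges left and right sides, hence the two parallel claims. *)
Lemma grid_unique h : inG h ->
  (forall g h1 h2 g1 g2, grid g h h1 g1 -> grid g h h2 g2 -> h1 = h2) /\
  (forall g h1 h2 g1 g2, grid g1 h h1 g -> grid g2 h h2 g -> h1 = h2).
Proof.
elim=> {h} [y|p|k _ [IH1 IH2]|k l e Hk [IHk1 IHk2] Hl [IHl1 IHl2]].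
- split=> g h1 h2 g1 g2 s1 s2; have [Hg _ _ Hg1] := grid_in s1.
    have [u [-> r1 _]] := (grid_letter s1).1 _ erefl.
    have [u' [-> r1' _]] := (grid_letter s2).1 _ erefl.
    by have [_ _ _ H _] := inG_good Hg Lp; rewrite (H _ _ _ r1 r1').
  have [u [-> _ r1]] := (grid_letter s1).1 _ erefl.
  have [u' [-> _ r1']] := (grid_letter s2).1 _ erefl.
  by have [_ _ _ H _] := inG_good Hg1 Ln; rewrite (H _ _ _ r1 r1').
- split=> g h1 h2 g1 g2 s1 s2.
    have [e1 _ _ _] := grid_ends s1; rewrite /= in e1; subst p.
    by rewrite (grid_id s1).1 // (grid_id s2).1.
  have [e1 e1' e3 _] := grid_ends s1; have [e2 e2' e4 _] := grid_ends s2.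
  rewrite /= in e1 e2; subst p.
  rewrite (grid_id s1).1 // in e1' *; rewrite (grid_id s2).1 ?e2 // in e2' *.
  by rewrite /= in e1' e2'; rewrite e1' e2'.
- split=> g h1 h2 g1 g2 /grid_flip s1 /grid_flip s2; rewrite rinvK in s1 s2.
    by rewrite -[h1]rinvK (IH2 _ _ _ _ _ s1 s2) rinvK.
  by rewrite -[h1]rinvK (IH1 _ _ _ _ _ s1 s2) rinvK.
split=> g h1 h2 g1 g2 /grid_split [/(_ _ _ Hk Hl e erefl) [a1 [c1 [m1 [s1 t1 ->]]]] _].
  move=> /grid_split [/(_ _ _ Hk Hl e erefl) [a2 [c2 [m2 [s2 t2 ->]]]] _].
  have ea := IHk1 _ _ _ _ _ s1 s2; subst a2.
  have em := grid_cancel s1 s2; subst m2.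
  by rewrite (IHl1 _ _ _ _ _ t1 t2).
move=> /grid_split [/(_ _ _ Hk Hl e erefl) [a2 [c2 [m2 [s2 t2 ->]]]] _].
have ec := IHl2 _ _ _ _ _ t1 t2; subst c2.
have em := grid_cancel' t1 t2; subst m2.
by rewrite (IHk2 _ _ _ _ _ s1 s2).
Qed.
End Relations.

(** * Horizontal pasting and the exchange of the two actions *)

Section ActionsCommute.
Variables (P : Type) (A : quiver P) (b : nd_braiding A).
Notation B := (box b).
Notation letter := (letter b).
Notation inG := (inG b).
Notation grid := (grid b).
Notation strip := (strip b).
Implicit Types (g h k : raw A) (x y u v : A).

(** Horizontal pasting is not a constructor of [grid]: take any grid over [rmul h k], cut it, and
    identify the halves with the given grids by uniqueness. *)
Lemma grid_hcomp g h h' g1 k k' g' :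
  grid g h h' g1 -> grid g1 k k' g' -> grid g (rmul h k) (rmul h' k') g'.
Proof.
move=> s t; have [Hg Hh _ _] := grid_in s; have [_ Hk _ _] := grid_in t.
have [e1 _ _ e2] := grid_ends s; have [e3 _ _ _] := grid_ends t.
have e : rtgt h = rsrc k by rewrite -e2.
have [l [m S]] := (grid_total Hg).1 _ (inG_mul e Hh Hk) e1.
have [a [c [n [s1 t1 e4]]]] := (grid_split S).1 _ _ Hh Hk e erefl.
have ea := (grid_unique Hh).1 _ _ _ _ _ s s1; subst a.
have en := grid_cancel s s1; subst n.
have ec := (grid_unique Hk).1 _ _ _ _ _ t t1; subst c.
by rewrite (grid_cancel t t1) -e4.
Qed.

(** Relational form of the exchange rule [up_dn_comm] around a square. *)
Definition commuting g h h' g' : Prop := forall a c d,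
  rrel h Tp a c -> rrel g Lp c d -> exists2 e, rrel g' Lp a e & rrel h' Tp e d.

(** The boxes through which [letter y] and [letter v] act form, with [H], one half of a cube; the
    other half contains those for [letter x] and [letter u]. *)
Lemma commuting_strip_box x y u v : B x y u v ->
  commuting (letter x) (letter y) (letter u) (letter v).
Proof.
move=> H a c d [k H1] [w H2].
have [_ _ h1 _] := box_ends H1; have [_ _ _ h2] := box_ends H.
have [e [e' H3]] := box_total b (etrans h2 h1).
have [u' [v' [w' [G1 G2 G3]]]] := ybe_right_left H1 H H3.
have [eu ev] := box_fun H2 G1; subst u' v'.
by exists e; [exists e'|exists w'].
Qed.

Lemma commuting_flip g h h' g' : inG g -> inG h -> inG g' -> rtgt g = rsrc h ->
  commuting g h h' g' -> commuting g' (rinv h) (rinv h') g.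
Proof.
move=> /inG_good Hg /inG_good Hh /inG_good Hg' e H a c d /= r1 r2.
have [h1 _ _ _ _] := Hh Tp; have [_ ha] := h1 _ _ r1.
have [_ g2 _ _ _] := Hg Lp; have [_ _ _ g4 _] := Hg' Lp.
have [f r3] := g2 a (etrans ha (esym e)).
have [d' r4 r5] := H _ _ _ r1 r3.
by exists f => //; rewrite (g4 _ _ _ r2 r4).
Qed.

Lemma commuting_inv g h h' g' : grid g h h' g' ->
  commuting g h h' g' -> commuting (rinv g) h' h (rinv g').
Proof.
move=> s H a c d /= r1 r2; have [e1 e2 e3 e4] := grid_ends s.
have [/inG_good Hg /inG_good Hh /inG_good Hh' /inG_good Hg'] := grid_in s.
have [h1 _ _ h4 _] := Hh' Tp; have [ha _] := h1 _ _ r1.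
have [g1 _ g3 _ _] := Hg' Lp; have [f r3] := g3 a (etrans ha e2).
have [hf _] := g1 _ _ r3.
have [_ h2 _ _ _] := Hh Tp; have [k r4] := h2 f (etrans hf e4).
have [k1 k2 _ _ k5] := Hg Lp.
have [l r5] : exists l, rrel g Lp k l.
  by apply: k2; rewrite e1; have [/(_ _ _ r4)[]] := Hh Tp.
have [a' r6 r7] := H _ _ _ r4 r5.
exists f => //; have [_ _ _ u _] := Hg' Lp.
rewrite -(u _ _ _ r3 r6) in r7.
rewrite -(h4 _ _ _ r1 r7) in r5.
by rewrite (k5 _ _ _ r2 r5).
Qed.

Lemma commuting_hcomp g h h' g1 k k' g' :
  commuting g h h' g1 -> commuting g1 k k' g' ->
  commuting g (rmul h k) (rmul h' k') g'.
Proof.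
move=> H1 H2 a c d [e r1 r2] r3.
have [f r4 r5] := H1 _ _ _ r2 r3; have [l r6 r7] := H2 _ _ _ r1 r4.
by exists l => //; exists f.
Qed.

Lemma commuting_strip h : inG h -> forall x h' x', strip x h h' x' ->
  commuting (letter x) h h' (letter x').
Proof.
elim=> {h} [y|p|k Hk IH|k l e Hk IHk Hl IHl] x h' x' S.
- have [u H] := strip_Tn S; rewrite (strip_fun S (strip_letter H)).
  exact: commuting_strip_box.
- have [/= e ep] := strip_Tn S; subst x'.
  rewrite /= in ep; subst p; rewrite (strip_fun S (strip_one b x)).
  move=> a c d /= [<- _] r; exists d => //; split=> //.
  by have [/(_ _ _ r)[]] := good_letter b x Lp.
- have := strip_inv S; rewrite rinvK => S'; have [e1 _ _ _] := strip_ends S'.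
  rewrite -[h']rinvK; apply: commuting_flip (IH _ _ _ S') => //; exact: inG_letter.
have [x1 /(strip_exists Hl)[l' Sl] /(strip_exists Hk)[k' Sk]] := strip_Tn S.
rewrite (strip_fun S (strip_mul Sk Sl)).
by apply: commuting_hcomp (IHk _ _ _ Sk) (IHl _ _ _ Sl).
Qed.

Lemma commuting_grid g h h' g' : grid g h h' g' -> commuting g h h' g'.
Proof.
elim=> {g h h' g'} [x h h' x' S|h H| |].
- exact: commuting_strip (strip_in S) _ _ _ S.
- move=> a c d r [<- _]; exists a => //; split=> //.
  by have [/(_ _ _ r)[]] := inG_good H Tp.
- move=> g1 g2 h h1 h2 g1' g2' _ H1 _ H2 a c d r1 [e r2 r3].
  have [f r4 r5] := H2 _ _ _ r1 r2; have [l r6 r7] := H1 _ _ _ r5 r3.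
  by exists l => //; exists f.
by move=> g h h' g' s; apply: commuting_inv.
Qed.
End ActionsCommute.

(** * The structural pair built from grids *)

Section StructureGroupoid.
Variables (P : Type) (A : quiver P) (b : nd_braiding A).
Notation B := (box b).

Definition sg_quiver : quiver P :=
  @Quiver P {f : raw A | inG b f} (fun f => rsrc (sval f)) (fun f => rtgt (sval f)).

Definition sg_comp (f g : sg_quiver) (h : tgt f = src g) : sg_quiver :=
  exist _ (rmul (sval f) (sval g)) (inG_mul h (svalP f) (svalP g)).
Definition sg_id (p : P) : sg_quiver := exist _ (rone A p) (inG_one b p).
Definition sg_inv (f : sg_quiver) : sg_quiver :=
  exist _ (rinv (sval f)) (inG_inv (svalP f)).

Lemma sg_good (f : sg_quiver) : good (sval f).
Proof. exact: inG_good (svalP f). Qed.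

Lemma sg_compA f g k h1 h2 h3 h4 :
  @sg_comp (@sg_comp f g h1) k h2 = @sg_comp f (@sg_comp g k h3) h4.
Proof. by apply: sval_inj; rewrite /= rmulA. Qed.

Lemma sg_comp1l p f h : @sg_comp (sg_id p) f h = f.
Proof. by apply: sval_inj; apply: rmul1l (sg_good f) (esym h). Qed.

Lemma sg_comp1r p f h : @sg_comp f (sg_id p) h = f.
Proof. by apply: sval_inj; apply: rmul1r (sg_good f) h. Qed.

Lemma sg_compV f h : @sg_comp f (sg_inv f) h = sg_id (src f).
Proof. by apply: sval_inj; apply: rmulV (sg_good f). Qed.

Lemma sg_compVl f h : @sg_comp (sg_inv f) f h = sg_id (tgt f).
Proof. by apply: sval_inj; apply: rmulVl (sg_good f). Qed.

Definition sg_groupoid : groupoid P :=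
  @Groupoid P sg_quiver sg_comp sg_id sg_inv (fun _ _ _ => erefl) (fun _ _ _ => erefl)
    (fun=> erefl) (fun=> erefl) (fun=> erefl) (fun=> erefl)
    sg_compA sg_comp1l sg_comp1r sg_compV sg_compVl.
Notation G := sg_groupoid.

Lemma sg_grid_exists (g h : G) : tgt g = src h ->
  exists p : G * G, grid b (sval g) (sval h) (sval p.1) (sval p.2).
Proof.
move=> e; have [h' [g' s]] := (grid_total (svalP g)).1 _ (svalP h) e.
have [_ _ Hh Hg] := grid_in s.
by exists (exist _ h' Hh : G, exist _ g' Hg : G).
Qed.

Definition sg_lfun (g h : G) (e : tgt g = src h) : G :=
  (projT1 (cid (sg_grid_exists e))).1.
Definition sg_rfun (g h : G) (e : tgt g = src h) : G :=
  (projT1 (cid (sg_grid_exists e))).2.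

Lemma sg_grid (g h : G) (e : tgt g = src h) :
  grid b (sval g) (sval h) (sval (sg_lfun e)) (sval (sg_rfun e)).
Proof. by rewrite /sg_lfun /sg_rfun; case: cid. Qed.

(** Every law of the two actions follows by pasting the grids on one side of it and identifying the
    outer sides of the result by this uniqueness. *)
Lemma sg_grid_uniq (g h : G) (e : tgt g = src h) h' g' :
  grid b (sval g) (sval h) h' g' ->
  sval (sg_lfun e) = h' /\ sval (sg_rfun e) = g'.
Proof.
move=> s; have s0 := sg_grid e.
have eh := (grid_unique (svalP h)).1 _ _ _ _ _ s s0; subst h'.
by rewrite (grid_cancel s s0).
Qed.

Lemma sg_lsrc g h e : src (@sg_lfun g h e) = src g.
Proof. by have [_ _ h1 _] := grid_ends (sg_grid e). Qed.

Lemma sg_rtgt g h e : tgt (@sg_rfun g h e) = tgt h.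
Proof. by have [_ _ _ h1] := grid_ends (sg_grid e). Qed.

Lemma sg_lM g k h h1 h2 h3 h4 :
  @sg_lfun g (@sg_lfun k h h1) h2 = @sg_lfun (gcomp g k h3) h h4.
Proof.
apply/esym/sval_inj.
exact: (sg_grid_uniq h4 (grid_mul (sg_grid h2) (sg_grid h1))).1.
Qed.

Lemma sg_l1 q h e : @sg_lfun (gid G q) h e = h.
Proof.
apply: sval_inj; have := grid_one (svalP h).
by rewrite -[rsrc _]/(src h) -e => /(sg_grid_uniq e)[].
Qed.

Definition sg_l : left_action G (@src P G) := LeftAction sg_lsrc sg_lM sg_l1.

Lemma sg_rM g h k h1 h2 h3 h4 :
  @sg_rfun (@sg_rfun g h h1) k h2 = @sg_rfun g (gcomp h k h3) h4.
Proof.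
apply/esym/sval_inj.
exact: (sg_grid_uniq h4 (grid_hcomp (sg_grid h1) (sg_grid h2))).2.
Qed.

Lemma grid_one_r (g : G) : grid b (sval g) (rone A (tgt g)) (rone A (src g)) (sval g).
Proof.
have [h' [g' s]] := (grid_total (svalP g)).1 _ (inG_one b (tgt g)) erefl.
have eh : h' = rone A (src g) := (grid_id s).1 erefl; subst h'.
have [_ _ _ /inG_good Hg'] := grid_in s; have [_ e _ _] := grid_ends s.
have := grid_LT s.
rewrite (rmul1r (sg_good g)) // (rmul1l Hg') // => eg.
by move: s; rewrite -eg.
Qed.

Lemma sg_r1 q g e : @sg_rfun g (gid G q) e = g.
Proof.
apply: sval_inj; have := grid_one_r g.
by rewrite e => /(sg_grid_uniq e)[].
Qed.

Definition sg_r : right_action G (@tgt P G) := RightAction sg_rtgt sg_rM sg_r1.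

Lemma sg_mid g h e : tgt (sg_l g h e) = src (sg_r g h e).
Proof. by have [_ ? _ _] := grid_ends (sg_grid e). Qed.

Lemma sg_lgM x f g h1 h2 h3 h4 h5 :
  sg_l x (gcomp f g h1) h2 =
  gcomp (sg_l x f h3) (sg_l (sg_r x f h3) g h4) h5.
Proof.
apply: sval_inj.
exact: (sg_grid_uniq h2 (grid_hcomp (sg_grid h3) (sg_grid h4))).1.
Qed.

Lemma sg_rgM x y g h1 h2 h3 h4 h5 :
  sg_r (gcomp x y h1) g h2 =
  gcomp (sg_r x (sg_l y g h3) h4) (sg_r y g h3) h5.
Proof.
apply: sval_inj.
exact: (sg_grid_uniq h2 (grid_mul (sg_grid h4) (sg_grid h3))).2.
Qed.

Definition sg_mp : matched_pair G G := MatchedPair sg_mid sg_lgM sg_rgM.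

Lemma sg_comm f g h h' :
  gcomp f g h = gcomp (mpl sg_mp f g h) (mpr sg_mp f g h) h'.
Proof. by apply: sval_inj; apply: grid_LT (sg_grid h). Qed.

Definition sg_braided : braided_groupoid P := BraidedGroupoid sg_comm.
Notation BG := sg_braided.

Section Action.
Variable m : mode.

Lemma sg_act_exists (g : BG) (a : A) : tgt g = endm m a ->
  exists c, rrel (sval g) m a c.
Proof. by move=> e; have [_ H _ _ _] := sg_good g m; apply: H. Qed.

Definition sg_actfun (g : BG) (a : A) (e : tgt g = endm m a) : A :=
  projT1 (cid (sg_act_exists e)).

Lemma sg_actP g a e : rrel (sval g) m a (@sg_actfun g a e).
Proof. by rewrite /sg_actfun; case: cid. Qed.

Lemma sg_act_uniq g a c e : rrel (sval g) m a c -> @sg_actfun g a e = c.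
Proof. by have [_ _ _ H _] := sg_good g m; apply: H (sg_actP e). Qed.

Lemma sg_act_src g a e : endm m (@sg_actfun g a e) = src g.
Proof. by have [/(_ _ _ (sg_actP e))[]] := sg_good g m. Qed.

Lemma sg_actM f g a h1 h2 h3 h4 :
  @sg_actfun f (@sg_actfun g a h1) h2 = @sg_actfun (gcomp f g h3) a h4.
Proof.
apply/esym/sg_act_uniq; exists (sg_actfun h1); exact: sg_actP.
Qed.

Lemma sg_act1 q a e : @sg_actfun (gid BG q) a e = a.
Proof. by apply: sg_act_uniq. Qed.

Definition sg_act : left_action BG (@endm P A m) :=
  LeftAction sg_act_src sg_actM sg_act1.

Lemma sg_act_rel (g : BG) a c : rrel (sval g) m a c <->
  tgt g = endm m a /\ la sg_act g a = c.
Proof.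
split=> [r|[e <-]]; last by rewrite -(laE _ e); apply: sg_actP.
have e : tgt g = endm m a by have [/(_ _ _ r)[]] := sg_good g m.
by split=> //; rewrite -(laE _ e); apply: sg_act_uniq.
Qed.
End Action.

Notation actL := (la (sg_act Lp)).
Notation actT := (la (sg_act Tp)).

Lemma actL_src (g : BG) a : tgt g = src a -> src (actL g a) = src g.
Proof. exact: (la_base (sg_act Lp)). Qed.

Lemma actT_src (g : BG) a : tgt g = src a -> src (actT g a) = src g.
Proof. exact: (la_base (sg_act Tp)). Qed.

Lemma act_commute (g h : BG) a : tgt g = src h -> tgt h = src a ->
  actL g (actT h a) = actT (la (up_l BG) g h) (actL (ra (up_r BG) g h) a).
Proof.
move=> e ea; have s := sg_grid e.
have r1 : rrel (sval h) Tp a (actT h a) by apply/sg_act_rel.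
have r2 : rrel (sval g) Lp (actT h a) (actL g (actT h a)).
  by apply/sg_act_rel; split=> //; rewrite e -(actT_src ea).
have [c r3 r4] := commuting_grid s r1 r2.
rewrite -(laE (up_l BG) e) -(raE (up_r BG) e).
have [_ ->] := (sg_act_rel Lp (up_r BG g h e) _ _).1 r3.
by have [_ ->] := (sg_act_rel Tp (up_l BG g h e) _ _).1 r4.
Qed.

(** The formula is forced by [rep_act_pair]; its compatibility with products rests on
    [act_commute]. *)
Definition sg_pair_fun (X : dgroupoid BG) (a : A) (_ : tgt X = src a) : A :=
  actT (sval X).1 (actL (sval X).2 a).

Lemma sg_pair_src X a e : src (@sg_pair_fun X a e) = src X.
Proof.
have e' : tgt (sval X).2 = src a := e.
by rewrite /sg_pair_fun actT_src // actL_src // qprodP.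
Qed.

Lemma sg_pairM X Y a h1 h2 h3 h4 :
  @sg_pair_fun X (@sg_pair_fun Y a h1) h2 = @sg_pair_fun (gcomp X Y h3) a h4.
Proof.
rewrite /sg_pair_fun dgroupoid_comp1 dgroupoid_comp2.
case: X Y h1 h2 h3 h4 => -[g k] hX [[g' k'] hY] h1 h2 h3 h4.
rewrite [sval _]/= [sval (exist _ (g', k') _)]/= [LHS]/= [RHS]/=.
have e1 : tgt k' = src a := h1.
have e2 : tgt k = src g' := h3.
have e3 : tgt g' = src k' := hY.
have e4 : tgt g = src k := hX.
have e5 : src (actL k' a) = src k' by apply: actL_src.
rewrite act_commute ?e5 //.
rewrite (la_cmp (sg_act Lp)) ?R_tgt // (la_cmp (sg_act Tp)) ?L_src //.
have e6 : tgt (ra (up_r BG) k g') = src (actL k' a) by rewrite R_tgt // e5.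
by rewrite L_tgt // -(actL_src e6).
Qed.

Lemma sg_pair1 q a h : @sg_pair_fun (gid (dgroupoid BG) q) a h = a.
Proof. by rewrite /sg_pair_fun /= (la1 (sg_act Lp)) ?(la1 (sg_act Tp)). Qed.

Definition sg_pair_act : left_action (dgroupoid BG) (@src P A) :=
  LeftAction sg_pair_src sg_pairM sg_pair1.

Definition sg_val : qmor A BG :=
  @QMor P A BG (fun x => exist _ (letter b x) (inG_letter b x))
    (fun=> erefl) (fun=> erefl).

Lemma sg_val_actL g a : tgt g = src a -> sg_val (actL g a) = la (up_l BG) g (sg_val a).
Proof.
move=> e; have e' : tgt g = src (sg_val a) := e.
apply/esym/sval_inj; rewrite -(laE _ e').
have [u [-> r _]] := (grid_letter (sg_grid e')).1 _ erefl.
by have [_ ->] := (sg_act_rel Lp g a u).1 r.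
Qed.

(** As [dn_l] inverts the braiding of the groupoid, it suffices to find a square with top [g] and
    right side [letter a]; the strip under [g] is one, and its left side is [letter x]. *)
Lemma sg_val_actT g a : tgt g = src a -> sg_val (actT g a) = la (dn_l BG) g (sg_val a).
Proof.
move=> e; pose x := actT g a.
have r : rrel (sval g) Tp a x by apply/sg_act_rel.
have [h S] := strip_exists' (svalP g) r.
have [e1 _ _ _] := strip_ends S.
pose h' : BG := exist _ h (strip_in S).
have e2 : tgt (sg_val x) = src h' := e1.
have [E1 E2] := sg_grid_uniq e2 (grid_strip S).
have F1 : la (up_l BG) (sg_val x) h' = g by apply: sval_inj; rewrite -(laE _ e2).
have F2 : ra (up_r BG) (sg_val x) h' = sg_val a by apply: sval_inj; rewrite -(raE _ e2).
by apply: etrans (esym (Ld_LR e2)) _; rewrite F1 F2.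
Qed.

Lemma sg_val_act X a h h' :
  sg_val (sg_pair_act X a h) = mpl (dbl_mp BG) X (sg_val a) h'.
Proof.
case: X h h' => -[g k] hX h h'.
have e1 : tgt k = src a := h.
have e2 : tgt g = src (actL k a) by rewrite actL_src.
rewrite [LHS](sg_val_actT e2) sg_val_actL //.
by apply/esym; apply: etrans (laE (dn_l BG) _) _; congr la; exact: (laE (up_l BG)).
Qed.

Definition sg_rep : representation (dbl_mp BG) A := Representation sg_val_act.

Lemma sg_up g a : tgt g = src a -> la (up_act sg_rep) g a = actL g a.
Proof.
move=> e; rewrite -(laE _ e) [LHS](la1 (sg_act Tp)) //.
exact: actL_src.
Qed.

Lemma sg_dn g a : tgt g = src a -> la (dn_act sg_rep) g a = actT g a.
Proof.
by move=> e; rewrite -(laE _ e); congr (actT _ _); apply: (la1 (sg_act Lp)).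
Qed.

Lemma sg_box x y u v : B x y u v -> rep_box sg_rep x y u v.
Proof.
move=> H; have [h hu huv hv] := box_ends H.
have [_ eu] : tgt (sg_val x) = src y /\ actL (sg_val x) y = u.
  by apply/(sg_act_rel Lp); exists v.
have [e ex] : tgt (sg_val u) = src v /\ actT (sg_val u) v = x.
  by apply/(sg_act_rel Tp); exists y.
split=> //; first by rewrite sg_up.
have e' : tgt (ginv (sg_val u)) = src x by rewrite ginv_tgt.
by rewrite sg_dn // -[in RHS]ex (laK (sg_act Tp)).
Qed.

Lemma sg_gen (g : BG) : generated (fun v => exists a, v = rep_val sg_rep a) g.
Proof.
case: g => f Hf; move: (Hf); elim: Hf => [x|p|k Hk IH|k l e Hk IHk Hl IHl] H.
- apply: generated_mem; exists x; exact: sval_inj.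
- have -> : exist _ _ H = gid BG p by exact: sval_inj.
  exact: generated_id.
- have -> : exist _ _ H = ginv (exist _ k Hk : BG) by exact: sval_inj.
  by apply: generated_inv.
have -> : exist _ _ H = gcomp (exist _ k Hk : BG) (exist _ l Hl : BG) e.
  exact: sval_inj.
by apply: generated_comp.
Qed.

Definition tagm (m : mode) (a : A) : qdouble A :=
  match m with Lp | Tp => inl a | Ln | Tn => inr a end.

Definition actD (m : mode) : left_action BG (@src P (qdouble A)) :=
  match m with
  | Lp | Ln => up_act (rep_double sg_rep)
  | Tp | Tn => dn_act (rep_double sg_rep)
  end.

Lemma tagm_src m a : src (tagm m a) = endm m a.
Proof. by case: m. Qed.

(** The relations stored in an element are recovered from the constructed actions on the double: on
    letters by the four box formulas, then along words. *)
Lemma actD_rel (g : BG) m a c : rrel (sval g) m a c ->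
  la (actD m) g (tagm m a) = tagm m c.
Proof.
case: g => f Hf; move: (Hf) m a c.
elim: Hf => [x|p|k Hk IH|k l e Hk IHk Hl IHl] H m a c.
- have -> : exist _ _ H = rep_val sg_rep x by exact: sval_inj.
  case: m => -[y /= /sg_box R].
  + exact: rep_box_upD_inl R.
  + exact: rep_box_upD_inr R.
  + exact: rep_box_dnD_inl R.
  exact: rep_box_dnD_inr R.
- have -> : exist _ _ H = gid BG p by exact: sval_inj.
  by case=> <- ea; rewrite la1 //; apply: etrans (tagm_src m a) ea.
- have -> : exist _ _ H = ginv (exist _ k Hk : BG) by exact: sval_inj.
move=> /= r; rewrite -(IH Hk _ _ _ r) laK //; apply: etrans (esym (tagm_src m c)).
  by have [/(_ _ _ r)[]] := inG_good Hk m.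
have -> : exist _ _ H = gcomp (exist _ k Hk : BG) (exist _ l Hl : BG) e.
  exact: sval_inj.
case=> d r1 r2; rewrite cmpE la_cmp //.
  by rewrite (IHl Hl _ _ _ r1) (IHk Hk _ _ _ r2).
apply: etrans (esym (tagm_src m a)).
by have [/(_ _ _ r1)[]] := inG_good Hl m.
Qed.

(** An element is given by its ends and its four relations, and [actD_rel] reads the relations off
    the two actions on the double. *)
Lemma sg_inj : injective (nabla (rep_double sg_rep)).
Proof.
move=> g g' /nabla_eq [|es et H].
  by move=> [a|a]; [exists (inr a)|exists (inl a)].
apply: sval_inj; apply: raw_sub => //; try exact: sg_good.
move=> m a c r; have [/(_ _ _ r)[ea _] _ _ _ _] := sg_good g m.
have [_ H2 _ _ _] := sg_good g' m; have [c' r'] := H2 a (etrans ea et).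
suff <- : c' = c by [].
have [Hu Hd] : la (up_act (rep_double sg_rep)) g (tagm m a) =
    la (up_act (rep_double sg_rep)) g' (tagm m a) /\
  la (dn_act (rep_double sg_rep)) g (tagm m a) =
    la (dn_act (rep_double sg_rep)) g' (tagm m a).
  by apply: H; rewrite tagm_src.
have : tagm m c = tagm m c'.
  rewrite -(actD_rel r) -(actD_rel r').
  by case: {r r' ea H2} m Hu Hd.
by case: {r r' ea H2 Hu Hd} m => -[].
Qed.

Definition structure_pair : structural_pair A := StructuralPair sg_gen sg_inj.
End StructureGroupoid.

Theorem theorem3p10 (P : Type) (P_nonempty : inhabited P) :
  exists F : forall A : quiver P, structural_pair A -> nd_braiding A,
  forall A : quiver P,
  [/\ forall (S : structural_pair A) (x y : A) (h : tgt x = src y),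
        qleft (F A S) h = rep_left S h /\ qright (F A S) h = rep_right S h,
      forall S S' : structural_pair A, F A S = F A S' <-> sp_isomorphic S S'
    & forall b : nd_braiding A, exists S : structural_pair A, F A S = b].
Proof.
exists (fun A (S : structural_pair A) => rep_nd_braiding S) => A; split.
- by move=> S x y h; apply: rep_braidingE.
- move=> S S'; split=> [E|/same_box_of_sp_isomorphic H].
    apply: sp_isomorphic_of_same_box => x y u v /box_rep_braiding.
    rewrite -[rep_braiding S]/(braiding (rep_nd_braiding S)) E.
    by move/box_rep_braiding.
  by apply: nd_braiding_eq => x y u v /box_rep_braiding/H/box_rep_braiding.
move=> b; exists (structure_pair b); apply: nd_braiding_eq => x y u v.
(* In both braidings the sides [x] and [y] determine the box, so it is enough that the box of [b] on
   these sides is one of the representation. *)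
move=> /box_rep_braiding R; have [h _ _] := R.
have [u' [v' H]] := box_total b h.
by have [-> ->] := rep_box_fun R (sg_box H).
Qed.
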